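(* Let $\alpha>0$. There exist simply connected domains $\Omega,\Omega'$ in $G^2_\alpha$ such that $\Omega\cap\{x=0\}$ and $\Omega'\cap\{x=0\}$ have the same number of connected components but there exists no orientation preserving conformal mapping $g\in HW^{1,\frac{2(\alpha+1)}{\alpha}}_{\mathrm{loc}}(\Omega,\Omega')$.
   Context: Fix $\alpha>0$. The Grushin plane $G^2_\alpha$ is $\mathbb{R}^2$ with the Carnot--Carath\'eodory metric induced by the vector fields $X=\partial_x$, $Y_\alpha=|x|^\alpha\partial_y$. ''A.e.'' and $L^p$ refer to Lebesgue measure on $\mathbb{R}^2$; homeomorphisms are from $\Omega$ onto $\Omega'$. Sobolev spaces. For $\Omega\subset G^2_\alpha$ open and $p\ge 1$, $HW^{1,p}(\Omega)$ is the space of $u\in L^p(\Omega)$ whose first weak partial derivatives exist and whose horizontal gradient $\nabla_H u=(Xu,Y_\alpha u)$ is in $L^p(\Omega)$. A map $g=(g_1,g_2):\Omega\to\Omega'$ is in $HW^{1,p}(\Omega,\Omega')$ if $g_1,g_2\in HW^{1,p}(\Omega)$, and in $HW^{1,p}_{\mathrm{loc}}(\Omega,\Omega')$ if $g\in HW^{1,p}(U,\Omega')$ for every $U\subset\subset\Omega$ (closures in the Euclidean topology). Partial derivatives are the usual Euclidean ones, which exist a.e. Orientation preserving. $g\in HW^{1,1}_{\mathrm{loc}}(\Omega,\Omega')$ is orientation preserving if $J_g=X(g_1)Y_\alpha(g_2)-X(g_2)Y_\alpha(g_1)>0$ a.e. in $\Omega$. Conformal. Let $S_g=\{(x,y)\in\Omega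 \mid x=0\ \text{or}\ g_1(x,y)=0\}$ and $R_g=\Omega\setminus S_g$. A homeomorphism $g=(g_1,g_2)\in HW^{1,2}_{\mathrm{loc}}(\Omega,\Omega')$ is conformal in $\Omega$ if: (1) the matrix $$D_\alpha g=\begin{bmatrix}X(g_1)&Y_\alpha(g_1)\\ \frac{X(g_2)}{|g_1|^\alpha}&\frac{Y_\alpha(g_2)}{|g_1|^\alpha}\end{bmatrix}$$ is equal, almost everywhere in $R_g$, to an orthogonal matrix multiplied by some positive function in $R_g$; and (2) for all points $(x_0,y_0)\in S_g$ the limit $\lim_{R_g\ni(x,y)\to(x_0,y_0)}D_\alpha g(x,y)$ is defined, finite and non-zero. *)

(* Defs.v *)
(* The Grushin plane is [R * R] with its product (Euclidean) topology, which is
   the topology of the Carnot-Caratheodory metric. *)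
From HB Require Import structures.
From mathcomp Require Import all_boot all_order all_algebra.
From mathcomp Require Import all_classical all_reals all_analysis.

Set Implicit Arguments.
Unset Strict Implicit.
Unset Printing Implicit Defensive.

Import Order.TTheory GRing.Theory Num.Theory numFieldNormedType.Exports.

Local Open Scope classical_set_scope.
Local Open Scope ring_scope.

Section Grushin.
Context {R : realType}.

Local Notation plane := (R * R)%type.

Implicit Types (U V : set plane) (u v : plane -> R) (g : plane -> plane)
  (z : plane).

Local Notation lebesgue2 := (@lebesgue_measure R \x @lebesgue_measure R)%E.

Definition dirx : plane := (1, 0).
Definition diry : plane := (0, 1).

Definition simply_connected U : Prop :=
  forall c : R -> plane,
    {within `[0, 1], continuous c} -> c @` `[0, 1] `<=` U -> c 0 = c 1 ->
  exists (h : plane -> plane) (a : plane),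
    [/\ {within `[0, 1] `*` `[0, 1], continuous h},
        h @` (`[0, 1] `*` `[0, 1]) `<=` U,
        forall t, t \in `[0, 1] -> h (0, t) = c t,
        forall t, t \in `[0, 1] -> h (1, t) = a &
        forall s, s \in `[0, 1] -> h (s, 0) = h (s, 1)].

Definition simply_connected_domain U : Prop :=
  [/\ open U, U !=set0, connected U & simply_connected U].

Definition components U : set (set plane) :=
  [set connected_component U z | z in U].

Definition y_axis : set plane := [set z | z.1 = 0].

(* Only the values of [g] on [U] matter. *)
Definition homeomorphism_onto U V g : Prop :=
  {within U, continuous g} /\
  exists g' : plane -> plane,
    [/\ {within V, continuous g'},
        g @` U `<=` V, g' @` V `<=` U,
        {in U, cancel g g'} & {in V, cancel g' g}].

Fixpoint Ck (n : nat) u : Prop :=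
  continuous u /\
  if n is m.+1 then
    forall e, e = dirx \/ e = diry ->
      (forall z, derivable u z e) /\ Ck m ('D_e u)
  else True.

Definition test_function U (phi : plane -> R) : Prop :=
  [/\ forall n, Ck n phi,
      compact (closure [set z | phi z != 0]) &
      closure [set z | phi z != 0] `<=` U].

(* [measurable_fun] is Borel measurability: Sobolev functions are represented
   by Borel functions, while null sets below are subsets of Borel null sets. *)
Definition Lp (p : R) U u : Prop :=
  measurable_fun U u /\
  (\int[lebesgue2]_(z in U) (`|u z| `^ p)%:E < +oo)%E.

Definition L1loc U u : Prop :=
  measurable_fun U u /\
  forall K : set plane, compact K -> K `<=` U ->
    (\int[lebesgue2]_(z in K) `|u z|%:E < +oo)%E.

Definition weak_partial U (e : plane) u v : Prop :=
  L1loc U v /\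
  forall phi : plane -> R, test_function U phi ->
    \int[lebesgue2]_(z in U) (u z * 'D_e phi z) =
    - \int[lebesgue2]_(z in U) (v z * phi z).

Definition HW (alpha p : R) U u : Prop :=
  Lp p U u /\
  exists ux uy : plane -> R,
    [/\ weak_partial U dirx u ux, weak_partial U diry u uy,
        Lp p U ux & Lp p U (fun z => `|z.1| `^ alpha * uy z)].

Definition HW_map (alpha p : R) U V g : Prop :=
  [/\ g @` U `<=` V, HW alpha p U (fst \o g) & HW alpha p U (snd \o g)].

Definition HW_map_loc (alpha p : R) U V g : Prop :=
  forall W : set plane,
    open W -> compact (closure W) -> closure W `<=` U -> HW_map alpha p W V g.

(* Pointwise partial derivatives, unlike the weak ones in [HW]. *)
Definition vfX u z : R := 'D_dirx u z.
Definition vfY (alpha : R) u z : R := `|z.1| `^ alpha * 'D_diry u z.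

(* ['D_e] takes an arbitrary value where the derivative does not exist, so
   [jacobian] and [Dmx] are only meaningful at points of this set, which has
   full measure; the limit in [conformal] is taken along it. *)
Definition has_partials g z : Prop :=
  forall e, e = dirx \/ e = diry ->
    derivable (fst \o g) z e /\ derivable (snd \o g) z e.

Definition jacobian (alpha : R) g z : R :=
  vfX (fst \o g) z * vfY alpha (snd \o g) z -
  vfX (snd \o g) z * vfY alpha (fst \o g) z.

Definition Dmx (alpha : R) g z : 'M[R]_2 :=
  \matrix_(i < 2, j < 2)
    if i == 0 then
      if j == 0 then vfX (fst \o g) z else vfY alpha (fst \o g) z
    else
      (if j == 0 then vfX (snd \o g) z else vfY alpha (snd \o g) z)
        / `|(g z).1| `^ alpha.

Definition orientation_preserving (alpha : R) U V g : Prop :=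
  HW_map_loc alpha 1 U V g /\
  {ae lebesgue2, forall z, U z -> has_partials g z /\ 0 < jacobian alpha g z}.

Definition singular U g : set plane :=
  [set z | U z /\ (z.1 = 0 \/ (g z).1 = 0)].

Definition regular U g : set plane := U `\` singular U g.

Definition conformal (alpha : R) U V g : Prop :=
  [/\ homeomorphism_onto U V g,
      HW_map_loc alpha 2 U V g,
      exists lambda : plane -> R,
        (forall z, regular U g z -> 0 < lambda z) /\
        {ae lebesgue2, forall z, regular U g z ->
           has_partials g z /\
           exists2 Q : 'M[R]_2, Q *m Q^T = 1%:M
             & Dmx alpha g z = lambda z *: Q} &
      forall z0, singular U g z0 ->
        exists2 L : 'M[R]_2, L != 0
          & Dmx alpha g z
              @[z --> within (regular U g `&` has_partials g) (nbhs z0)] --> L].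

End Grushin.

(* Main.v *)
Require Import Defs.
From mathcomp Require Import all_boot all_order all_algebra.
From mathcomp Require Import all_classical all_reals all_analysis.
From mathcomp Require Import measurable_realfun ring lra.
Import Order.TTheory GRing.Theory Num.Theory numFieldNormedType.Exports.
Local Open Scope classical_set_scope.
Local Open Scope ring_scope.

Set Implicit Arguments.
Unset Strict Implicit.
Unset Printing Implicit Defensive.

(** The two domains meet the axis x = 0 in the same set, three segments, but the
    segments are arranged differently. In [snake], a strip along the graph of
    y^3 - 4y, they are crossed one after another; in [star] they are the roots
    of three teeth attached to a common region, [core]. Cutting along the three
    segments gives a path of four pieces in the first case and a star of four
    pieces in the second, so no homeomorphism carries the axis of [snake] into
    the axis of [star] ([snake_star_axis]).

    A conformal map, on the other hand, must carry the axis into the axis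
    ([conformal_axis]). The second column of the matrix D_alpha g contains the
    factor |x|^alpha, which vanishes on the axis, whereas the matrix has a nonzero
    limit at every point of the axis and is, by conformality and orientation, a
    positive multiple of a rotation almost everywhere. If g1 does not vanish at
    a point of the axis, a y-derivative of g1 or of g2 therefore grows like
    |x|^-alpha with constant sign near that point ([conformal_growth]).
    Integrating along vertical lines close to the axis contradicts the
    continuity of g ([vertical_blowup]).

    The integration is the analytic core: the growth concerns pointwise partial
    derivatives that exist almost everywhere, and these alone do not control
    increments. Weak differentiability does: testing with products of smooth
    plateaus shows that on almost every vertical line the function is the
    integral of its weak derivative, and Lebesgue differentiation then
    identifies the weak derivative with the pointwise one
    ([vertical_growth]). *)

(** * Almost everywhere statements and integrals *)

Section AlmostEverywhere.
Context {R : realType} {d : measure_display} {T : measurableType d}.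
Variable m : {measure set T -> \bar R}.
Implicit Types P Q S : T -> Prop.

Lemma ae_imply P Q : {ae m, forall x, P x} -> (forall x, P x -> Q x) ->
  {ae m, forall x, Q x}.
Proof. by move=> aeP PQ; apply: negligibleS aeP => x /= nQ Px; exact/nQ/PQ. Qed.

Lemma ae_imply2 P Q S : {ae m, forall x, P x} -> {ae m, forall x, Q x} ->
  (forall x, P x -> Q x -> S x) -> {ae m, forall x, S x}.
Proof.
move=> aeP aeQ PQS; apply: negligibleS (negligibleU aeP aeQ) => x /= nS.
by apply: contrapT => /not_orP[/contrapT Px /contrapT Qx]; exact/nS/PQS.
Qed.

End AlmostEverywhere.

Section Integration.
Context {R : realType} {d : measure_display} {T : measurableType d}.
Variable m : {measure set T -> \bar R}.

Lemma integrable_mulr_bounded (D : set T) (f h : T -> R) (C : R) :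
  measurable D -> m.-integrable D (EFin \o f) -> measurable_fun D h ->
  (forall x, D x -> `|h x| <= C) ->
  m.-integrable D (EFin \o (fun x => f x * h x)).
Proof.
move=> mD fi mh hC.
have bh : [bounded h x | x in D].
  exists C; split; first exact: num_real.
  by move=> M CM x Dx; apply: le_trans (ltW CM); exact: hC.
have -> : EFin \o (fun x => f x * h x) = ((EFin \o f) \* (EFin \o h))%E.
  by apply/funext => x; rewrite /= EFinM.
exact: integrableMl.
Qed.

Lemma integrable_sub (D : set T) (f g : T -> R) : measurable D ->
  m.-integrable D (EFin \o f) -> m.-integrable D (EFin \o g) ->
  m.-integrable D (EFin \o (fun x => f x - g x)).
Proof.
move=> mD fi gi.
have -> : EFin \o (fun x => f x - g x) = ((EFin \o f) \- (EFin \o g))%E.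
  by apply/funext => x; rewrite /= EFinB.
exact: integrableB.
Qed.

Lemma integrable_add (D : set T) (f g : T -> R) : measurable D ->
  m.-integrable D (EFin \o f) -> m.-integrable D (EFin \o g) ->
  m.-integrable D (EFin \o (fun x => f x + g x)).
Proof.
move=> mD fi gi.
have -> : EFin \o (fun x => f x + g x) = ((EFin \o f) \+ (EFin \o g))%E.
  by apply/funext => x; rewrite /= EFinD.
exact: integrableD.
Qed.

Lemma integrable_mull (D : set T) (c : R) (f : T -> R) : measurable D ->
  m.-integrable D (EFin \o f) -> m.-integrable D (EFin \o (fun x => c * f x)).
Proof.
move=> mD fi.
have -> : EFin \o (fun x => c * f x) = (fun x => c%:E * (EFin \o f) x)%E.
  by apply/funext => x; rewrite /= EFinM.
exact: integrableZl.
Qed.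

Lemma integrable_bounded (D : set T) (f : T -> R) (C : R) :
  measurable D -> (m D < +oo)%E -> measurable_fun D f ->
  (forall x, D x -> `|f x| <= C) -> m.-integrable D (EFin \o f).
Proof.
move=> mD mDy mf fC; apply: measurable_bounded_integrable => //.
exists C; split; first exact: num_real.
by move=> M CM x Dx; apply: le_trans (ltW CM); exact: fC.
Qed.

Lemma dominated_Rintegral (f_ : nat -> T -> R) (f g : T -> R) :
  (forall n, measurable_fun setT (f_ n)) -> measurable_fun setT f ->
  (forall x, f_ n x @[n --> \oo] --> f x) ->
  m.-integrable setT (EFin \o g) -> (forall n x, `|f_ n x| <= g x) ->
  \int[m]_x f_ n x @[n --> \oo] --> \int[m]_x f x.
Proof.
move=> mf_ mf f_f ig f_g.
have [|||||fi _ H] := @dominated_convergence _ T R m setT measurableT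
  (fun n => EFin \o f_ n) (EFin \o f) (EFin \o g).
- by move=> n; exact/measurable_EFinP.
- exact/measurable_EFinP.
- by apply: aeW => x _; apply: cvg_EFin; [exact: nearW|exact: f_f].
- exact: ig.
- by apply: aeW => x n _; rewrite /= lee_fin.
have fin : (\int[m]_x (EFin \o f) x \is a fin_num)%E by exact: integrable_fin_num.
by rewrite /Rintegral; apply: fine_cvg; rewrite fineK.
Qed.

End Integration.

(** * Smooth step functions *)

(** Derivability at every order already gives continuity of every derivative,
    so continuity is not listed as in [Ck]. *)
Fixpoint Ck1 {R : realType} (n : nat) (phi : R -> R) : Prop :=
  (forall t, derivable phi t 1) /\
  if n is m.+1 then Ck1 m (derive1 phi) else True.

Definition smooth {R : realType} (phi : R -> R) := forall n, Ck1 n phi.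

Section SmoothStep.
Context {R : realType}.
Implicit Types (phi psi : R -> R) (n k : nat) (t : R).

Lemma Ck1_derivable n phi t : Ck1 n phi -> derivable phi t 1.
Proof. by case: n => [|n] [dphi _]; exact: dphi. Qed.

Lemma Ck1W n phi : Ck1 n.+1 phi -> Ck1 n phi.
Proof. by elim: n phi => [|n IH] phi [dphi Cphi]; split => //; exact: IH. Qed.

Lemma Ck1_is_derive n phi dphi :
  (forall t, is_derive t 1 phi (dphi t)) -> Ck1 n dphi -> Ck1 n.+1 phi.
Proof.
move=> phiE Cd; split => [t|]; first by have [] := phiE t.
suff -> : derive1 phi = dphi by [].
by apply/funext => t; rewrite derive1E; exact: derive_val.
Qed.

Lemma Ck1S_derive n phi t : Ck1 n phi -> is_derive t 1 phi (derive1 phi t).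
Proof.
by move=> /(@Ck1_derivable _ _ t) dphi; rewrite derive1E; exact: derivableP.
Qed.

Lemma Ck1_cst n (c : R) : Ck1 n (cst c).
Proof.
elim: n c => [|n IH] c; first by split => // t; exact: derivable_cst.
by apply: (@Ck1_is_derive _ _ (cst 0)) => // t; exact: is_derive_cst.
Qed.

Lemma Ck1D n phi psi : Ck1 n phi -> Ck1 n psi -> Ck1 n (phi \+ psi).
Proof.
elim: n phi psi => [|n IH] phi psi Cphi Cpsi.
  by split => // t; apply: derivableD; exact: (@Ck1_derivable 0).
apply: (@Ck1_is_derive _ _ (derive1 phi \+ derive1 psi)) => [t|].
  by have := is_deriveD (Ck1S_derive t Cphi) (Ck1S_derive t Cpsi).
by apply: IH; [case: Cphi|case: Cpsi].
Qed.

(** Induction closes because the product rule sends a product to a sum of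
    products of functions of one order less. *)
Lemma Ck1M n phi psi : Ck1 n phi -> Ck1 n psi -> Ck1 n (phi \* psi).
Proof.
elim: n phi psi => [|n IH] phi psi Cphi Cpsi.
  by split => // t; apply: derivableM; exact: (@Ck1_derivable 0).
apply: (@Ck1_is_derive _ _
  ((phi \* derive1 psi) \+ (psi \* derive1 phi))) => [t|].
  by have := is_deriveM (Ck1S_derive t Cphi) (Ck1S_derive t Cpsi).
apply: Ck1D; apply: IH; (try exact: Ck1W); [by case: Cpsi|by case: Cphi].
Qed.

Lemma Ck1V n phi :
  (forall t, phi t != 0) -> Ck1 n phi -> Ck1 n (fun t => (phi t)^-1).
Proof.
move=> phi0; elim: n => [|n IH] Cphi.
  split => // t; apply: derivableV => //; exact: (@Ck1_derivable 0).
apply: (@Ck1_is_derive _ _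
  ((fun t => (phi t)^-1) \* (fun t => (phi t)^-1) \* (cst (- 1) \* derive1 phi))).
  move=> t; have := is_deriveV (phi0 t) (Ck1S_derive t Cphi).
  move=> dV; apply: is_derive_eq; rewrite /GRing.scale/= -exprVn; ring.
have CV : Ck1 n (fun t => (phi t)^-1) by apply: IH; exact: Ck1W.
apply: Ck1M; first exact: Ck1M.
by apply: Ck1M; [exact: Ck1_cst|case: Cphi].
Qed.

Lemma is_derive_affine phi (l a t : R) n : Ck1 n phi ->
  is_derive t 1 (fun t => phi (l * (t - a))) (derive1 phi (l * (t - a)) * l).
Proof.
move=> Cphi; have dB : is_derive t 1 (fun t => t - a) (1 - 0).
  exact: (is_deriveB (is_derive_id t 1) (is_derive_cst a t 1)).
have dZ : is_derive t 1 (fun t => l * (t - a)) (l * (1 - 0)).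
  exact: (is_deriveZ l dB).
rewrite subr0 mulr1 in dZ.
exact: (is_derive1_comp (Ck1S_derive _ Cphi) dZ).
Qed.

Lemma Ck1_affine n phi (l a : R) :
  Ck1 n phi -> Ck1 n (fun t => phi (l * (t - a))).
Proof.
elim: n phi => [|n IH] phi Cphi.
  by split => // t; have [] := is_derive_affine l a t Cphi.
have dphi t := is_derive_affine l a t Cphi.
apply: (Ck1_is_derive dphi); apply: (@Ck1M n (fun t => _ (_ * (t - _))) (cst l)).
  by apply: IH; case: Cphi.
exact: Ck1_cst.
Qed.

(** The functions t^-k exp(-1/t), extended by zero, form a family that
    differentiation maps into its own linear span; every member is therefore
    smooth as soon as every member is derivable. *)
Definition flat k t : R := if 0 < t then t^-1 ^+ k * expR (- t^-1) else 0.

(** Comparison of the exponential with its Taylor term of order k+2; this makes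
    the difference quotients at the origin vanish in the limit. *)
Lemma flat_le k t : `|flat k t| <= (k.+2)`!%:R * t ^+ 2.
Proof.
rewrite /flat; case: ifPn => [t0|_]; last by rewrite normr0 mulr_ge0// sqr_ge0.
rewrite ger0_norm; last by rewrite mulr_ge0// ?expR_ge0// exprn_ge0// invr_ge0 ltW.
rewrite expRN ler_pdivrMr ?expR_gt0//.
have t1 : 0 <= t^-1 by rewrite invr_ge0 ltW.
have H := expR_ge1Dxn k.+1 t1.
have F0 : 0 < (k.+2)`!%:R :> R by rewrite ltr0n fact_gt0.
have {}H : t^-1 ^+ k.+2 <= (k.+2)`!%:R * expR t^-1.
  by rewrite mulrC -ler_pdivrMr//; apply: le_trans H; rewrite lerDr.
have -> : t^-1 ^+ k = t ^+ 2 * t^-1 ^+ k.+2.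
  by rewrite !exprS expr0 !mulr1; field; rewrite gt_eqF.
rewrite [leRHS](_ : _ = t ^+ 2 * ((k.+2)`!%:R * expR t^-1)); last by ring.
by apply: ler_wpM2l H; exact: sqr_ge0.
Qed.

Lemma is_derive_flat k t :
  is_derive t 1 (flat k) (flat k.+2 t - k%:R * flat k.+1 t).
Proof.
have [t0|t0|->] := ltgtP t 0.
- rewrite /flat !ltNge (ltW t0)/= mulr0 subr0.
  apply: near_eq_is_derive (is_derive_cst 0 t 1).
  near=> s; rewrite ifF// ltNge; apply/negbF/ltW; near: s; exact: lt_nbhsl.
- rewrite /flat t0.
  have tn0 : id t != 0 by rewrite gt_eqF.
  have dV := is_deriveV tn0 (is_derive_id t 1).
  have dN : is_derive t 1 (fun s : R => - s^-1) (t ^- 2).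
    have := is_deriveN dV; rewrite /GRing.scale/= mulr1 opprK; exact.
  have dE := @is_derive1_comp _ expR (fun s => - s^-1) _ _ _ (is_derive_expR _) dN.
  have dX := is_deriveX k dV.
  have dM := is_deriveM dX dE.
  have nE : \forall s \near t,
      ([eta GRing.inv] ^+ k * (expR \o (fun s : R => - s^-1))) s = flat k s.
    near=> s; rewrite /flat ifT ?fctE//; near: s; exact: lt_nbhsr.
  have {}dM := near_eq_is_derive nE dM.
  apply: is_derive_eq.
  rewrite !fctE /GRing.scale/= !mulr1 -!exprVn; case: k {dX dM nE} => [|k].
    by ring.
  by rewrite !exprS /=; ring.
rewrite {2 3}/flat ltxx mulr0 subr0.
have K0 : 0 < (k.+2)`!%:R :> R by rewrite ltr0n fact_gt0.
have F : h^-1 *: (flat k (h *: 1 + 0) - flat k 0) @[h --> (0:R)^'] --> (0:R).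
  apply/cvgrPdist_le => e e0; near=> h.
  have h0 : h != 0 by near: h; exact: nbhs_dnbhs_neq.
  rewrite sub0r normrN {2}/flat ltxx subr0 /GRing.scale/= mulr1 addr0.
  rewrite normrM normfV ler_pdivrMl ?normr_gt0//.
  apply: (le_trans (flat_le _ _)); rewrite -real_normK ?num_real// expr2.
  rewrite mulrCA ler_pM2l ?normr_gt0// -ler_pdivlMl// mulrC.
  near: h; apply: dnbhs0_le; exact: divr_gt0.
by split; [apply/cvg_ex; exists 0|apply/cvg_lim].
Unshelve. all: by end_near. Qed.

Lemma smooth_flat k : smooth (flat k).
Proof.
move=> n; elim: n k => [|n IH] k.
  by split => // t; have [] := is_derive_flat k t.
apply: (@Ck1_is_derive _ _ (flat k.+2 \+ (cst (- k%:R) \* flat k.+1))).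
  by move=> t; have := is_derive_flat k t; rewrite /= mulNr.
by apply: Ck1D => //; apply: Ck1M => //; exact: Ck1_cst.
Qed.

Lemma flat_ge0 k t : 0 <= flat k t.
Proof.
rewrite /flat; case: ifPn => // t0.
by rewrite mulr_ge0 ?expR_ge0// exprn_ge0// invr_ge0 ltW.
Qed.

Lemma flat_gt0 k t : 0 < t -> 0 < flat k t.
Proof. by move=> t0; rewrite /flat t0 mulr_gt0 ?expR_gt0// exprn_gt0// invr_gt0. Qed.

Lemma flat_le0 k t : t <= 0 -> flat k t = 0.
Proof. by rewrite /flat ltNge => ->. Qed.

(** A smooth function rising from 0 to 1 on the unit interval; the denominator
    never vanishes because t and 1 - t are not both nonpositive. *)
Definition step t : R := flat 0 t / (flat 0 t + flat 0 (1 - t)).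

Let den_gt0 t : 0 < flat 0 t + flat 0 (1 - t).
Proof.
have [t0|t0] := ltP 0 t; first by rewrite ltr_pwDl ?flat_gt0 ?flat_ge0.
by rewrite ltr_wpDl ?flat_ge0// flat_gt0//; lra.
Qed.

Lemma smooth_step : smooth step.
Proof.
move=> n; rewrite /step; apply: Ck1M; first exact: smooth_flat.
apply: Ck1V => [t|]; first by rewrite gt_eqF ?den_gt0.
apply: Ck1D; first exact: smooth_flat.
have -> : (fun t => flat 0 (1 - t)) = (fun t => flat 0 (- 1 * (t - 1))).
  by apply/funext => t; congr (flat 0 _); ring.
by apply: Ck1_affine; exact: smooth_flat.
Qed.

Lemma step0 t : t <= 0 -> step t = 0.
Proof. by move=> t0; rewrite /step flat_le0// mul0r. Qed.

Lemma step1 t : 1 <= t -> step t = 1.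
Proof.
move=> t1; rewrite /step [X in _ + X]flat_le0 ?addr0 ?mulfV ?gt_eqF ?flat_gt0//; lra.
Qed.

Lemma step_ge0 t : 0 <= step t.
Proof. by rewrite divr_ge0 ?flat_ge0// ltW. Qed.

Lemma step_le1 t : step t <= 1.
Proof. by rewrite ler_pdivrMr// mul1r lerDl flat_ge0. Qed.

Lemma derivable_step t : derivable step t 1.
Proof. exact: Ck1_derivable (smooth_step 0%N). Qed.

Lemma continuous_dstep : continuous (derive1 step).
Proof.
move=> t; apply/differentiable_continuous/derivable1_diffP.
by have [_ [+ _]] := @smooth_step 1%N; exact.
Qed.

Lemma dstep0 t : t < 0 \/ 1 < t -> derive1 step t = 0.
Proof.
move=> [t0|t1]; rewrite derive1E.
  rewrite (@near_eq_derive _ _ _ _ (cst 0)) ?derive_cst//.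
  by near=> s; rewrite step0//; apply/ltW; near: s; exact: lt_nbhsl.
rewrite (@near_eq_derive _ _ _ _ (cst (1 : R))) ?derive_cst//.
by near=> s; rewrite step1//; apply/ltW; near: s; exact: lt_nbhsr.
Unshelve. all: by end_near. Qed.

Lemma dstep_bounded : exists2 C, 0 < C & forall t, `|derive1 step t| <= C.
Proof.
have [C [_ HC]] : bounded_set ((derive1 step) @` `[0, 1]).
  apply: compact_bounded; apply: continuous_compact; last exact: segment_compact.
  by apply: continuous_subspaceT; exact: continuous_dstep.
exists (`|C| + 1) => [|t]; first by rewrite ltr_wpDl.
have [t01|] := boolP (t \in `[0, 1]).
  apply: (HC (`|C| + 1)); last by exists t.
  by rewrite (le_lt_trans (ler_norm _))// ltrDl.
rewrite in_itv/= negb_and -!ltNge => t01.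
by rewrite dstep0 ?normr0 ?addr_ge0//; apply/orP.
Qed.

End SmoothStep.

(** * Plateaus and one-sided mollifiers *)

Section Plateau.
Context {R : realType}.
Local Notation mu := (@lebesgue_measure R).
Implicit Types (a b q t : R) (n : nat) (v w : R -> R).

(** A smooth approximation from the right of the indicator of the interval from
    a to q: it is supported in [a, q + 1/(n+1)] and its slopes are two copies
    of the same mollifier, placed at a and at q. *)
Definition plateau n a q t := step (n.+1%:R * (t - a)) - step (n.+1%:R * (t - q)).

(** The derivative of the rescaled step: unit mass, concentrated on
    [a, a + 1/(n+1)]. It lies to the right of a, so that it tests the right
    limit at a and a plateau starting at the edge of a box stays in the box. *)
Definition mollifier n a t := derive1 step (n.+1%:R * (t - a)) * n.+1%:R.

Lemma is_derive_step n a t :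
  is_derive t 1 (fun t => step (n.+1%:R * (t - a))) (mollifier n a t).
Proof. exact: is_derive_affine (smooth_step 0%N). Qed.

Lemma smooth_plateau n a q : smooth (plateau n a q).
Proof.
move=> k; have -> : plateau n a q = (fun t => step (n.+1%:R * (t - a))) \+
    (cst (- 1) \* (fun t => step (n.+1%:R * (t - q)))).
  by apply/funext => t; rewrite /plateau/= mulN1r.
apply: Ck1D; first by apply: Ck1_affine; exact: smooth_step.
by apply: Ck1M; [exact: Ck1_cst|apply: Ck1_affine; exact: smooth_step].
Qed.

Lemma derive1_plateau n a q t :
  derive1 (plateau n a q) t = mollifier n a t - mollifier n q t.
Proof.
rewrite derive1E; have := is_deriveB (is_derive_step n a t) (is_derive_step n q t).
by move=> H; exact: derive_val.
Qed.

Lemma plateau_eq0 n a q t : a <= q ->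
  t \notin `[a, q + n.+1%:R^-1] -> plateau n a q t = 0.
Proof.
move=> aq; have n0 : 0 < n.+1%:R :> R by rewrite ltr0n.
rewrite in_itv/= negb_and -!ltNge => /orP[ta|tq].
  by rewrite /plateau !step0 ?subrr// pmulr_rle0// subr_le0 ltW// (lt_le_trans ta).
have q1 : 1 <= n.+1%:R * (t - q).
  by rewrite mulrC -ler_pdivrMr// div1r lerBrDl ltW.
rewrite /plateau !step1 ?subrr//; apply: le_trans q1 _.
by rewrite ler_pM2l// lerB.
Qed.

Lemma plateau_le1 n a q t : `|plateau n a q t| <= 1.
Proof.
rewrite /plateau ler_norml; have := @step_ge0 R; have := @step_le1 R => H1 H0.
have := H0 (n.+1%:R * (t - a)); have := H0 (n.+1%:R * (t - q)).
have := H1 (n.+1%:R * (t - a)); have := H1 (n.+1%:R * (t - q)); lra.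
Qed.

Lemma step_cvg a t :
  step (n.+1%:R * (t - a)) @[n --> \oo] --> ((a < t)%R%:R : R).
Proof.
have [ta|ta] := leP t a.
  rewrite (_ : (fun n => _) = cst 0); first exact: cvg_cst.
  by apply/funext => n; rewrite step0// pmulr_rle0 ?ltr0n// subr_le0.
have ta0 : 0 < t - a by rewrite subr_gt0.
apply: cvg_near_cst; near=> n; rewrite step1//.
rewrite -ler_pdivrMr// div1r invf_ple ?posrE ?ltr0n//; apply/ltW; near: n.
exact: (near_infty_natSinv_lt (PosNum ta0)).
Unshelve. all: by end_near. Qed.

Lemma plateau_cvg a q t : a <= q ->
  plateau n a q t @[n --> \oo] --> (\1_(`]a, q]%classic) t : R).
Proof.
move=> aq; rewrite /plateau.
have -> : \1_(`]a, q]%classic) t = (a < t)%R%:R - (q < t)%R%:R :> R.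
  rewrite indicE; case: (ltP a t) => at_; last first.
    by rewrite memNset ?ltNge ?(le_trans at_ aq) ?subrr//= in_itv/= ltNge at_.
  have [tq|tq] := leP t q.
    by rewrite mem_set ?subr0//= in_itv/= at_ tq.
  by rewrite memNset ?subrr//= in_itv/= at_ leNgt tq.
by apply: cvgB; exact: step_cvg.
Qed.

Lemma measurable_plateau n a q : measurable_fun setT (plateau n a q).
Proof.
apply: continuous_measurable_fun => t.
apply/differentiable_continuous/derivable1_diffP.
exact: Ck1_derivable (@smooth_plateau n a q 0%N).
Qed.

Lemma plateau_int v a q : a <= q -> mu.-integrable setT (EFin \o v) ->
  \int[mu]_t (v t * plateau n a q t) @[n --> \oo] --> \int[mu]_(t in `]a, q]) v t.
Proof.
move=> aq iv; rewrite Rintegral_mkcond.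
have mv : measurable_fun setT v by apply/measurable_EFinP; exact: measurable_int iv.
have -> : v \_ `]a, q] = v \* (\1_(`]a, q]%classic) : R -> R).
  apply/funext => t; rewrite patchE /= indicE.
  by case: ifPn; rewrite ?mulr1 ?mulr0.
apply: (@dominated_Rintegral _ _ _ mu _ _ (fun t => `|v t|)).
- by move=> n; apply: measurable_funM => //; exact: measurable_plateau.
- by apply: measurable_funM => //; exact: measurable_indic.
- by move=> t; apply: cvgMr; exact: plateau_cvg.
- exact: integrable_norm.
- by move=> n t; rewrite normrM ler_piMr// plateau_le1.
Qed.

End Plateau.

Section Mollifier.
Context {R : realType}.
Local Notation mu := (@lebesgue_measure R).
Implicit Types (a b q t : R) (n : nat) (v w : R -> R).

Lemma continuous_mollifier n a : continuous (mollifier n a).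
Proof.
have dk t : derivable (mollifier n a) t 1.
  have [_ C0] := @smooth_step R 1%N.
  have dS := @Ck1_affine _ 0%N _ n.+1%:R a C0.
  apply: derivableM; [exact: Ck1_derivable dS|exact: derivable_cst].
by move=> t; apply/differentiable_continuous/derivable1_diffP.
Qed.

Lemma measurable_mollifier n a : measurable_fun setT (mollifier n a).
Proof. by apply: continuous_measurable_fun; exact: continuous_mollifier. Qed.

Lemma mollifier_bounded : exists2 C : R, 0 < C &
  forall n a t, `|mollifier n a t| <= C * n.+1%:R.
Proof.
have [C C0 HC] := @dstep_bounded R; exists C => // n a t.
by rewrite normrM (ger0_norm (ler0n _ _)) ler_wpM2r.
Qed.

Lemma mollifier_eq0 n a t : t \notin `[a, a + n.+1%:R^-1] -> mollifier n a t = 0.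
Proof.
have n0 : 0 < n.+1%:R :> R by rewrite ltr0n.
rewrite in_itv/= negb_and -!ltNge => tN; rewrite /mollifier dstep0 ?mul0r//.
case/orP: tN => [ta|ta]; first by left; rewrite pmulr_rlt0// subr_lt0.
by right; rewrite mulrC -ltr_pdivrMr// div1r ltrBrDl.
Qed.

Lemma mollifier_mass n a : \int[mu]_(t in `[a, a + n.+1%:R^-1]) mollifier n a t = 1.
Proof.
have n0 : 0 < n.+1%:R^-1 :> R by rewrite invr_gt0 ltr0n.
have dS t := is_derive_step n a t.
have cS : continuous (fun t => step (n.+1%:R * (t - a))).
  move=> t; apply/differentiable_continuous/derivable1_diffP.
  by have [] := dS t.
rewrite /Rintegral (@continuous_FTC2 _ _ (fun t => step (n.+1%:R * (t - a)))).
- have -> : n.+1%:R * (a + n.+1%:R^-1 - a) = 1 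
    by rewrite [a + _]addrC addrK mulfV// pnatr_eq0.
  by rewrite /= subrr mulr0 step1// step0// subr0.
- by rewrite ltrDl.
- by apply: continuous_subspaceT; exact: continuous_mollifier.
- split; first by move=> t _; have [] := dS t.
    by apply: cvg_at_right_filter; exact: cS.
  by apply: cvg_at_left_filter; exact: cS.
- by move=> t _; rewrite derive1E; exact: derive_val.
Qed.

(** The mollifier has unit mass, and its absolute mass stays bounded by the
    maximal slope of the step function; hence only the oscillation of w just to
    the right of a matters. *)
Lemma mollifier_int w a :
  mu.-integrable setT (EFin \o w) -> w t @[t --> a^'+] --> w a ->
  \int[mu]_t (w t * mollifier n a t) @[n --> \oo] --> w a.
Proof.
move=> iw wa; have [C C0 HC] := mollifier_bounded.
apply/cvgrPdist_le => e e0.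
have eC : 0 < e / C by rewrite divr_gt0.
have /= [d d0 Hd] := (@cvgrPdist_le _ _ _ _ _ _ _).1 wa _ eC.
near=> n; pose D := `[a, a + n.+1%:R^-1]%classic.
have nd : n.+1%:R^-1 < d by near: n; exact: (near_infty_natSinv_lt (PosNum d0)).
have mD : measurable D by exact: measurable_itv.
have muD : mu D = (n.+1%:R^-1)%:E.
  rewrite lebesgue_measure_itv/= lte_fin ltrDl invr_gt0 ltr0n/=.
  by rewrite -EFinB [a + _]addrC addrK.
have muDy : (mu D < +oo)%E by rewrite muD ltry.
have mk : measurable_fun D (mollifier n a).
  exact: measurable_funS (measurable_mollifier n a).
have ik : mu.-integrable D (EFin \o mollifier n a).
  exact: (integrable_bounded (m := mu) mD muDy mk (fun x _ => HC n a x)).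
have iwD : mu.-integrable D (EFin \o w) by exact: integrableS iw.
have iwk : mu.-integrable D (EFin \o (fun t => w t * mollifier n a t)).
  exact: (integrable_mulr_bounded (m := mu) mD iwD mk (fun x _ => HC n a x)).
have iak : mu.-integrable D (EFin \o (fun t => w a * mollifier n a t)).
  exact: integrable_mull.
have -> : \int[mu]_t (w t * mollifier n a t) = \int[mu]_(t in D) (w t * mollifier n a t).
  rewrite [RHS]Rintegral_mkcond; apply: eq_Rintegral => t _; rewrite patchE.
  case: ifPn => // tD; rewrite mollifier_eq0 ?mulr0//.
  by apply: contra tD => tD; rewrite mem_set.
rewrite -[X in X - _]mulr1 -[X in w a * X](mollifier_mass n a) -RintegralZl//.
rewrite -RintegralB//.
have iB : mu.-integrable D
    (EFin \o (fun t => w a * mollifier n a t - w t * mollifier n a t)).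
  exact: integrable_sub.
apply: (le_trans (le_normr_Rintegral (mu := mu) mD iB)).
have -> : e = \int[mu]_(_ in D) (e * n.+1%:R).
  by rewrite (Rintegral_cst mu mD) [X in fine X]muD/= mulfK// pnatr_eq0.
apply: le_Rintegral => //.
- exact: integrable_norm.
- by apply: (integrable_bounded (C := `|e * n.+1%:R|)) => //; exact: muDy.
move=> t; rewrite /D/= in_itv/= => /andP[].
rewrite le_eqVlt => /predU1P[<- _|at_ ta].
  by rewrite subrr normr0 mulr_ge0// ltW.
rewrite -mulrBl normrM.
have -> : e * n.+1%:R = e / C * (C * n.+1%:R) by field; rewrite gt_eqF.
apply: ler_pM => //; apply: Hd => //=.
rewrite ltr0_norm ?subr_lt0// opprB ltrBlDl.
by apply: le_lt_trans ta _; rewrite ltrD2l.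
Unshelve. all: by end_near. Qed.

End Mollifier.

(** * Integrating weak derivatives on a line *)

Section Primitive.
Context {R : realType}.
Local Notation mu := (@lebesgue_measure R).
Implicit Types (a b c d q t : R) (n : nat) (H v w : R -> R).

Let near_infty_lt (c d : R) : c < d -> \forall n \near \oo, c + n.+1%:R^-1 <= d.
Proof.
move=> cd; have cd0 : 0 < d - c by rewrite subr_gt0.
near=> n; rewrite -lerBrDl; apply/ltW; near: n.
exact: (near_infty_natSinv_lt (PosNum cd0)).
Unshelve. all: by end_near. Qed.

Let FTC1_integrable v a : mu.-integrable setT (EFin \o v) ->
  {ae mu, forall t, a < t ->
    derivable (fun x => \int[mu]_(s in `]a, x]) v s) t 1 /\
    derive1 (fun x => \int[mu]_(s in `]a, x]) v s) t = v t}.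
Proof.
move=> iv.
have iv' y : mu.-integrable [set` Interval (BRight a) (BRight y)] (EFin \o v).
  exact: integrableS iv.
have lv : locally_integrable setT v.
  by apply: open_integrable_locally => //; exact: openT.
by apply: ae_imply (FTC1 iv' lv) _ => t + at_; apply; rewrite lte_fin.
Qed.

(** Du Bois-Reymond: letting the ramps shrink, the integral of H over every
    initial subinterval is zero, so H, which is almost everywhere the derivative
    of these integrals, vanishes. *)
Lemma plateau_vanish H c d : mu.-integrable setT (EFin \o H) ->
  (forall n q, c < q -> q + n.+1%:R^-1 <= d ->
    \int[mu]_t (H t * plateau n c q t) = 0) ->
  {ae mu, forall t, c < t < d -> H t = 0}.
Proof.
move=> iH H0; have F0 t : c < t < d -> \int[mu]_(s in `]c, t]) H s = 0.
  move=> /andP[ct td]; have cP := plateau_int (ltW ct) iH.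
  apply: (cvg_unique (@Rhausdorff R) cP).
  apply: cvg_near_cst; have := near_infty_lt td.
  by apply: filterS => n; exact: H0.
apply: ae_imply (FTC1_integrable c iH) _ => t Ht /andP[ct td].
have [_ <-] := Ht ct; rewrite derive1E.
rewrite (@near_eq_derive _ _ _ _ (cst 0)) ?derive_cst//.
have : t \in `]c, d[ by rewrite in_itv/= ct td.
move=> /near_in_itvoo; apply: filterS => x; rewrite in_itv/=; exact: F0.
Qed.

(** The weak derivative tested on plateaus is Newton-Leibniz in the limit: the
    two slopes evaluate w at a and at q, and the plateau itself integrates v
    between them. *)
Lemma plateau_primitive v w a b q : a < q < b ->
  mu.-integrable setT (EFin \o v) -> mu.-integrable setT (EFin \o w) ->
  w t @[t --> a^'+] --> w a -> w t @[t --> q^'+] --> w q ->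
  (forall n, q + n.+1%:R^-1 <= b ->
    \int[mu]_t (w t * derive1 (plateau n a q) t + v t * plateau n a q t) = 0) ->
  w q - w a = \int[mu]_(t in `]a, q]) v t.
Proof.
move=> /andP[aq qb] iv iw wa wq I0.
have cL := cvgD (cvgB (mollifier_int iw wa) (mollifier_int iw wq))
  (plateau_int (ltW aq) iv).
suff L0 : w a - w q + \int[mu]_(t in `]a, q]) v t = 0.
  by rewrite -[RHS](addKr (w a - w q)) L0 addr0 opprB.
have [C C0 HC] := @mollifier_bounded R.
apply: (cvg_unique (@Rhausdorff R) (cL _ _)); apply: cvg_near_cst.
apply: filterS (near_infty_lt qb) => n /I0 <-.
have iwk x : mu.-integrable setT (EFin \o (fun t => w t * mollifier n x t)).
  apply: (integrable_mulr_bounded (C := C * n.+1%:R)) => //.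
  exact: measurable_mollifier.
have ivp : mu.-integrable setT (EFin \o (fun t => v t * plateau n a q t)).
  apply: (integrable_mulr_bounded (C := 1)) => //; first exact: measurable_plateau.
  by move=> x _; exact: plateau_le1.
transitivity (\int[mu]_t (w t * mollifier n a t - w t * mollifier n q t +
                          v t * plateau n a q t)).
  rewrite RintegralD//; last exact: integrable_sub.
  by rewrite RintegralB.
by apply: eq_Rintegral => t _; rewrite /= derive1_plateau [w t * (_ - _)]mulrBr.
Qed.

(** A singular function could have derivative at least K almost everywhere and
    still decrease; here w is the integral of v, so Lebesgue differentiation
    identifies v with the derivative of w and the bound can be integrated.
    Rational endpoints suffice by continuity, and they are what a countable
    intersection of sets of full measure can provide. *)
Lemma growth_primitive v w a b q (K : R) : a < q < b ->
  mu.-integrable setT (EFin \o v) ->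
  (forall r : rat, a < ratr r < b ->
    w (ratr r) - w a = \int[mu]_(t in `]a, ratr r]) v t) ->
  (forall t, a < t < b -> {for t, continuous w}) ->
  {ae mu, forall t, a < t < b -> derivable w t 1 /\ K <= derive1 w t} ->
  K * (q - a) <= w q - w a.
Proof.
move=> /andP[aq qb] iv wr cw dw.
pose F x := \int[mu]_(s in `]a, x]) v s.
have Fc t : a < t < b -> {for t, continuous F}.
  move=> /andP[at_ tb].
  have ab : a < b by exact: lt_trans tb.
  have iab : mu.-integrable `[a, b] (EFin \o v) by exact: integrableS iv.
  have := parameterized_integral_continuous (ltW ab) iab.
  have -> : (parameterized_integral mu a)^~ v = F.
    apply/funext => x; rewrite /parameterized_integral /F.
    by rewrite Rintegral_itv_obnd_cbnd//; exact: integrableS iv.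
  by move=> /within_continuous_continuous; apply => //; rewrite in_itv/= at_ tb.
have wF t : a < t < b -> w t - w a = F t.
  move=> tab; apply/eqP; rewrite -subr_eq0; apply: contrapT => /negP g0.
  pose g t := w t - w a - F t.
  have cg : {for t, continuous g}.
    by apply: cvgB; [apply: cvgB; [exact: cw|exact: cvg_cst]|exact: Fc].
  have tin : t \in `]a, b[ by rewrite in_itv.
  have [e /= e0 He] : \forall s \near t, g s != 0 /\ s \in `]a, b[.
    near=> s; split; last by near: s; exact: near_in_itvoo.
    near: s; have /cvgrPdist_lt/(_ `|g t|) := cg.
    rewrite normr_gt0 => /(_ g0); apply: filterS => s.
    by apply: contraTneq => ->; rewrite subr0 ltxx.
  have [r] := @rat_in_itvoo R (t - e) (t + e) ltac:(lra).
  rewrite in_itv/= => rt; have /= := He (ratr r).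
  rewrite ltr_distlC => /(_ rt) [+ rab].
  rewrite in_itv/= in rab; by rewrite /g wr// subrr eqxx.
have vK : {ae mu, forall t, a < t < b -> K <= v t}.
  apply: ae_imply2 (FTC1_integrable a iv) dw _ => t H1 H2 tab.
  have [ _ Kw] := H2 tab; have /andP[at_ _] := tab.
  have [_ <-] := H1 at_; suff -> : derive1 F t = derive1 w t by [].
  rewrite !derive1E; have [dwt _] := H2 tab.
  rewrite (@near_eq_derive _ _ _ F (fun s => w s - w a)).
    by rewrite deriveB ?derive_cst ?subr0//; exact: derivable_cst.
  have tin : t \in `]a, b[ by rewrite in_itv.
  by apply: filterS (near_in_itvoo tin) => s; rewrite in_itv/= => /wF ->.
rewrite wF ?aq// /F.
have mq : measurable (`]a, q]%classic : set (measurableTypeR R)).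
  exact: measurable_itv.
have iq : mu.-integrable `]a, q] (EFin \o v) by exact: integrableS iv.
have muq : mu `]a, q]%classic = (q - a)%:E.
  by rewrite lebesgue_measure_itv/= lte_fin aq EFinB.
have mv : measurable_fun (`]a, q]%classic : set (measurableTypeR R)) v.
  by apply/measurable_EFinP; exact: measurable_int iq.
have -> : K * (q - a) = \int[mu]_(t in `]a, q]) K.
  by rewrite (Rintegral_cst mu mq) [X in fine X]muq.
have iK : mu.-integrable `]a, q] (EFin \o cst K).
  by apply: (integrable_bounded (C := `|K|)) => //; rewrite [X in (X < _)%E]muq ltry.
have -> : \int[mu]_(t in `]a, q]) v t = \int[mu]_(t in `]a, q]) Num.max K (v t).
  rewrite /Rintegral; congr fine; apply: ae_eq_integral => //.
  - by apply/measurable_EFinP.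
  - by apply/measurable_EFinP; apply: measurable_maxr.
  apply: ae_imply vK _ => t Kt; rewrite /= in_itv/= => /andP[at_ tq].
  by rewrite max_r// Kt// at_ (le_lt_trans tq).
apply: le_Rintegral => //; last by move=> t _; rewrite le_max lexx.
have iKv := integrable_add mq (integrable_norm iK) (integrable_norm iq).
apply: (le_integrable mq _ _ iKv) => //.
  by apply/measurable_EFinP; exact: measurable_maxr.
move=> t _; rewrite /= lee_fin (ger0_norm (addr_ge0 _ _))//.
by rewrite /Num.max; case: ifP => _; rewrite ?lerDl ?lerDr.
Unshelve. all: by end_near. Qed.

End Primitive.

(** * Partial derivatives and tensor test functions *)

Section Partials.
Context {R : realType}.
Implicit Types (f : R * R -> R) (z : R * R) (phi psi : R -> R).

(** The difference quotients in a coordinate direction are literally those of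
    the restriction to the line, which transfers derivability and derivatives
    at once. *)
Let quotient_dirx f z :
  (fun h : R => h^-1 *: ((f \o shift z) (h *: dirx) - f z)) =
  (fun h : R => h^-1 *:
     (((fun x => f (x, z.2)) \o shift z.1) (h *: (1 : R)) - f (z.1, z.2))).
Proof.
apply/funext => h; case: z => x y.
rewrite /shift /= (_ : h *: dirx + (x, y) = (h%:A + x, h *: 0 + y))//.
by rewrite scaler0 add0r.
Qed.

Let quotient_diry f z :
  (fun h : R => h^-1 *: ((f \o shift z) (h *: diry) - f z)) =
  (fun h : R => h^-1 *:
     (((fun y => f (z.1, y)) \o shift z.2) (h *: (1 : R)) - f (z.1, z.2))).
Proof.
apply/funext => h; case: z => x y.
rewrite /shift /= (_ : h *: diry + (x, y) = (h *: 0 + x, h%:A + y))//.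
by rewrite scaler0 add0r.
Qed.

Lemma derivable_dirx f z :
  derivable f z dirx = derivable (fun x => f (x, z.2)) z.1 1.
Proof. by rewrite /derivable quotient_dirx. Qed.

Lemma derivable_diry f z :
  derivable f z diry = derivable (fun y => f (z.1, y)) z.2 1.
Proof. by rewrite /derivable quotient_diry. Qed.

Lemma derive_dirx f z : 'D_dirx f z = derive1 (fun x => f (x, z.2)) z.1.
Proof. by rewrite derive1E /derive quotient_dirx. Qed.

Lemma derive_diry f z : 'D_diry f z = derive1 (fun y => f (z.1, y)) z.2.
Proof. by rewrite derive1E /derive quotient_diry. Qed.

Lemma smooth_derive1 phi : smooth phi -> smooth (derive1 phi).
Proof. by move=> Cphi n; have [_] := Cphi n.+1. Qed.

Lemma smooth_continuous phi : smooth phi -> continuous phi.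
Proof.
move=> Cphi t; apply/differentiable_continuous/derivable1_diffP.
exact: Ck1_derivable (Cphi 0%N).
Qed.

(** Products of functions of one variable are all the test functions used. *)
Definition tensor phi psi z := phi z.1 * psi z.2.

Lemma derive_tensor phi psi : smooth phi -> smooth psi ->
  (forall z, derivable (tensor phi psi) z dirx) /\
  (forall z, derivable (tensor phi psi) z diry) /\
  'D_dirx (tensor phi psi) = tensor (derive1 phi) psi /\
  'D_diry (tensor phi psi) = tensor phi (derive1 psi).
Proof.
move=> Cphi Cpsi.
have dx z : is_derive z.1 1 (fun x => tensor phi psi (x, z.2))
    (derive1 phi z.1 * psi z.2).
  have := is_deriveM (Ck1S_derive z.1 (Cphi 0%N)) (is_derive_cst (psi z.2) z.1 1).
  by rewrite scaler0 add0r [derive1 phi z.1 * _]mulrC.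
have dy z : is_derive z.2 1 (fun y => tensor phi psi (z.1, y))
    (phi z.1 * derive1 psi z.2).
  have := is_deriveM (is_derive_cst (phi z.1) z.2 1) (Ck1S_derive z.2 (Cpsi 0%N)).
  by rewrite scaler0 addr0.
split=> [z|]; first by rewrite derivable_dirx; have [] := dx z.
split=> [z|]; first by rewrite derivable_diry; have [] := dy z.
split; apply/funext => z.
  by rewrite derive_dirx derive1E; exact: derive_val.
by rewrite derive_diry derive1E; exact: derive_val.
Qed.

Lemma continuous_tensor phi psi : continuous phi -> continuous psi ->
  continuous (tensor phi psi).
Proof.
move=> cphi cpsi z; apply: cvgM.
  by apply: continuous_comp; [exact: cvg_fst|exact: cphi].
by apply: continuous_comp; [exact: cvg_snd|exact: cpsi].
Qed.

Lemma Ck_tensor n phi psi : smooth phi -> smooth psi -> Ck n (tensor phi psi).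
Proof.
elim: n phi psi => [|n IH] phi psi Cphi Cpsi.
  by split => //; apply: continuous_tensor; exact: smooth_continuous.
split; first by apply: continuous_tensor; exact: smooth_continuous.
have [dx [dy [Dx Dy]]] := derive_tensor Cphi Cpsi.
move=> e [|] ->; split => //.
  by rewrite Dx; apply: IH => //; exact: smooth_derive1.
by rewrite Dy; apply: IH => //; exact: smooth_derive1.
Qed.

Definition box (c d a b : R) : set (R * R) := `[c, d]%classic `*` `[a, b]%classic.

Lemma compact_box (c d a b : R) : compact (box c d a b).
Proof. by apply: compact_setX; exact: segment_compact. Qed.

Lemma closed_box (c d a b : R) : closed (box c d a b).
Proof.
apply: compact_closed; last exact: compact_box.
exact: (@norm_hausdorff _ (R * R)%type).
Qed.

Lemma test_tensor (W : set (R * R)) phi psi (c d a b : R) :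
  smooth phi -> smooth psi -> box c d a b `<=` W ->
  (forall t, t \notin `[c, d] -> phi t = 0) ->
  (forall t, t \notin `[a, b] -> psi t = 0) ->
  test_function W (tensor phi psi).
Proof.
move=> Cphi Cpsi boxW phi0 psi0.
have supp : closure [set z | tensor phi psi z != 0] `<=` box c d a b.
  rewrite [X in _ `<=` X](closure_id _).1; last exact: closed_box.
  apply: closure_subset => z /= z0; split => /=; apply: contrapT => /negP zN.
    by move: z0; rewrite /tensor phi0// mul0r eqxx.
  by move: z0; rewrite /tensor psi0// mulr0 eqxx.
split; first by move=> n; exact: Ck_tensor.
  apply: (subclosed_compact _ (@compact_box c d a b) supp).
  exact: closed_closure.
exact: subset_trans boxW.
Qed.

End Partials.

(** * Slices of product measures *)

Section Slices.
Context {R : realType} {d1 d2 : measure_display}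
  {T1 : measurableType d1} {T2 : measurableType d2}.
Variables (m1 : {sigma_finite_measure set T1 -> \bar R})
  (m2 : {sigma_finite_measure set T2 -> \bar R}).

(** The measure of a product-null set is the integral of the measures of its
    slices. *)
Lemma ae_slice (P : T1 * T2 -> Prop) :
  {ae (m1 \x m2)%E, forall z, P z} ->
  {ae m1, forall x, {ae m2, forall y, P (x, y)}}.
Proof.
move=> [N [mN N0 PN]].
have mx : measurable_fun setT (m2 \o xsection N) by exact: measurable_fun_xsection.
have : (\int[m1]_x `|(m2 \o xsection N) x| = 0)%E.
  rewrite -[RHS]N0 /product_measure1; apply: eq_integral => x _.
  by rewrite gee0_abs.
move=> /(ae_eq_integral_abs m1 measurableT mx) => aeN.
apply: ae_imply aeN _ => x /(_ I) Nx0.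
exists (xsection N x); split => //; first exact: measurable_xsection.
by move=> y /= nP; apply/xsectionP; exact: PN.
Qed.

Lemma slice_integral (G : T1 * T2 -> R) :
  (m1 \x m2)%E.-integrable setT (EFin \o G) ->
  m1.-integrable setT (EFin \o (fun x => \int[m2]_y G (x, y))).
Proof.
move=> iG; have iF := integrable_fubini_F iG.
have mF := measurable_int _ iF.
apply: le_integrable iF => //.
  apply/measurable_EFinP; apply: (measurableT_comp _ mF).
  exact: fine_measurable.
move=> x _; rewrite /= /Rintegral /fubini_F.
by case: (X in (`|(fine X)%:E| <= `|X|)%E) => [r| |] //=; rewrite normr0 leey.
Qed.

(** Fubini with a bounded weight depending on the first variable only, stated
    for the real-valued slice integrals. *)
Lemma slice_integralM (G : T1 * T2 -> R) (phi : T1 -> R) (C : R) :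
  (m1 \x m2)%E.-integrable setT (EFin \o G) ->
  measurable_fun setT phi -> (forall x, `|phi x| <= C) ->
  \int[m1]_x ((\int[m2]_y G (x, y)) * phi x) =
  \int[(m1 \x m2)%E]_z (G z * phi z.1).
Proof.
move=> iG mphi bphi.
have mphi1 : measurable_fun setT (fun z : T1 * T2 => phi z.1).
  by apply: measurableT_comp mphi _; exact: measurable_fst.
have iGp := integrable_mulr_bounded measurableT iG mphi1 (fun z _ => bphi z.1).
rewrite /Rintegral; congr fine.
rewrite -(integral12_prod_meas1 iGp).
apply: ae_eq_integral => //.
- apply/measurable_EFinP; apply: measurable_funM => //.
  by apply/measurable_EFinP; exact: measurable_int (slice_integral iG).
- by have := measurable_int _ (integrable_fubini_F iGp).
apply: ae_imply (ae_integrable1 iG) _ => x iGx _.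
rewrite /fubini_F /=; under [RHS]eq_integral do rewrite mulrC EFinM.
rewrite integralZl// mulrC EFinM; congr (_ * _)%E.
by rewrite /Rintegral fineK//; exact: integrable_fin_num.
Qed.

End Slices.

(** * Growth along vertical lines *)

Section VerticalGrowth.
Context {R : realType}.
Local Notation mu := (@lebesgue_measure R).
Local Notation lebesgue2 := (mu \x mu)%E.
Implicit Types (f v : R * R -> R) (W : set (R * R)) (a b c d : R).

Lemma measurable_box c d a b :
  measurable (box c d a b : set (measurableTypeR R * measurableTypeR R)).
Proof. by apply: measurableX; exact: measurable_itv. Qed.

Lemma lebesgue2_box c d a b : c <= d -> a <= b ->
  lebesgue2 (box c d a b) = ((d - c) * (b - a))%:E.
Proof.
move=> cd ab; rewrite /box product_measure1E; [|exact: measurable_itv..].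
have E (x y : R) : x <= y -> mu `[x, y]%classic = (y - x)%:E.
  move=> xy; rewrite lebesgue_measure_itv/= lte_fin.
  by case: ltP => [|yx]; rewrite ?EFinB// (@le_anti _ _ x y) ?xy ?subee.
by rewrite EFinM; congr (_ * _)%E; exact: E.
Qed.

Lemma ae_itv_ex (P : R -> Prop) c d : c < d -> {ae mu, forall x, P x} ->
  exists2 x, c < x < d & P x.
Proof.
move=> cd aeP; apply: contrapT => nP.
have negl : mu.-negligible (`]c, d[%classic : set (measurableTypeR R)).
  apply: negligibleS aeP => x /=; rewrite in_itv/= => xcd Px.
  by apply: nP; exists x.
have : mu `]c, d[%classic = 0%E.
  by apply: measure_negligible negl; exact: measurable_itv.
rewrite lebesgue_measure_itv/= lte_fin cd -EFinB => /eqP.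
by rewrite eqe subr_eq0 gt_eqF.
Qed.

(** Fubini applied to the test function phi(x) psi(y) with psi fixed shows that
    the defect of the weak derivative on the slice at x integrates to zero
    against every plateau phi, hence is zero for almost every x. The function
    and its weak derivative are cut off outside the box, where the test
    functions vanish anyway, to make them integrable. *)
Lemma weak_partial_slices W f v c d a b :
  c < d -> a < b -> measurable W -> box c d a b `<=` W -> measurable_fun W f ->
  (forall z, box c d a b z -> {for z, continuous f}) ->
  weak_partial W diry f v ->
  let fK := f \_ (box c d a b) in let vK := v \_ (box c d a b) in
  {ae mu, forall x, mu.-integrable setT (EFin \o (fun y => fK (x, y)))} /\
  {ae mu, forall x, mu.-integrable setT (EFin \o (fun y => vK (x, y)))} /\
  forall n q, a < q -> q + n.+1%:R^-1 <= b ->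
    {ae mu, forall x, c < x < d ->
      \int[mu]_y (fK (x, y) * derive1 (plateau n a q) y +
                  vK (x, y) * plateau n a q y) = 0}.
Proof.
move=> cd ab mW KW mf cf [[mv iv] wv] fK vK.
have mK := measurable_box c d a b.
have ifK : lebesgue2.-integrable setT (EFin \o fK).
  rewrite /fK -restrict_EFin; apply/(integrable_mkcond _ mK).
  have [|C [_ HC]] := @compact_bounded _ _ (f @` box c d a b).
    apply: continuous_compact; last exact: compact_box.
    by apply: continuous_in_subspaceT => z /set_mem; exact: cf.
  apply: (integrable_bounded (C := `|C| + 1)) => //.
  - have : (lebesgue2 (box c d a b) < +oo)%E by rewrite lebesgue2_box ?ltry ?ltW.
    exact.
  - exact: measurable_funS mf.
  move=> z Kz; apply: (HC (`|C| + 1)); last by exists z.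
  by rewrite (le_lt_trans (ler_norm _))// ltrDl.
have ivK : lebesgue2.-integrable setT (EFin \o vK).
  rewrite /vK -restrict_EFin; apply/(integrable_mkcond _ mK).
  apply/integrableP; split.
    by apply/measurable_EFinP; exact: measurable_funS mv.
  exact: iv (@compact_box _ c d a b) KW.
split; first exact: (ae_integrable1 ifK).
split; first exact: (ae_integrable1 ivK).
move=> n q aq qb.
pose psi := plateau n a q.
have Cpsi : smooth psi := smooth_plateau n a q.
have psi0 t : t \notin `[a, b] -> psi t = 0.
  move=> tab; apply: plateau_eq0 (ltW aq) _; apply: contra tab.
  by rewrite !in_itv/= => /andP[-> /le_trans]; exact.
have [C C0 HC] := @mollifier_bounded R.
have mpsi : measurable_fun setT (fun z : R * R => psi z.2).
  by apply: measurableT_comp (measurable_plateau n a q) _; exact: measurable_snd.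
have mdpsi : measurable_fun setT (fun z : R * R => derive1 psi z.2).
  apply: (@measurableT_comp _ _ _ _ _ _ (derive1 psi)); last exact: measurable_snd.
  apply: continuous_measurable_fun; apply: smooth_continuous.
  exact: smooth_derive1.
pose G (z : R * R) := fK z * derive1 psi z.2 + vK z * psi z.2.
have i1 : lebesgue2.-integrable setT (EFin \o (fun z => fK z * derive1 psi z.2)).
  apply: (integrable_mulr_bounded (C := 2 * (C * n.+1%:R))) => // z _.
  rewrite derive1_plateau (le_trans (ler_normB _ _))// mulr_natl mulr2n.
  by apply: lerD; exact: HC.
have i2 : lebesgue2.-integrable setT (EFin \o (fun z => vK z * psi z.2)).
  apply: (integrable_mulr_bounded (C := 1)) => // z _; exact: plateau_le1.
have iG : lebesgue2.-integrable setT (EFin \o G) by exact: integrable_add.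
apply: (plateau_vanish (slice_integral iG)) => k r cr rd.
pose phi := plateau k c r.
have Cphi : smooth phi := smooth_plateau k c r.
have phi0 t : t \notin `[c, d] -> phi t = 0.
  move=> tcd; apply: plateau_eq0 (ltW cr) _; apply: contra tcd.
  by rewrite !in_itv/= => /andP[-> /le_trans]; exact.
have [_ [_ [_ Dphi]]] := derive_tensor Cphi Cpsi.
have wE := wv _ (test_tensor Cphi Cpsi KW phi0 psi0).
have mk (g : R * R -> R) (h : R -> R) : (forall t, t \notin `[a, b] -> h t = 0) ->
    \int[lebesgue2]_(z in W) (g z * (phi z.1 * h z.2)) =
    \int[lebesgue2]_z ((g \_ (box c d a b)) z * h z.2 * phi z.1).
  move=> h0; rewrite Rintegral_mkcond; apply: eq_Rintegral => z _.
  rewrite !patchE; case: (pselect (box c d a b z)) => [Kz|nKz].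
    by rewrite !mem_set//; [ring|exact: KW].
  rewrite [in RHS]memNset// !mul0r; case: ifPn => // _.
  have [z1|z1] := boolP (z.1 \in `[c, d]); last by rewrite phi0// mul0r mulr0.
  have [z2|z2] := boolP (z.2 \in `[a, b]); last by rewrite h0// !mulr0.
  by case: nKz; split.
have dpsi0 t : t \notin `[a, b] -> derive1 psi t = 0.
  move=> tab; rewrite derive1_plateau !mollifier_eq0 ?subrr//; apply: contra tab.
    by rewrite !in_itv/= => /andP[qt /le_trans ->//]; rewrite (le_trans (ltW aq)).
  rewrite !in_itv/= => /andP[-> /le_trans ->//].
  by rewrite (le_trans _ qb)// lerD2r ltW.
have E : \int[lebesgue2]_z (fK z * derive1 psi z.2 * phi z.1) =
         - \int[lebesgue2]_z (vK z * psi z.2 * phi z.1).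
  rewrite -(mk _ _ dpsi0) -(mk _ _ psi0) -[RHS]wE.
  by apply: eq_Rintegral => z _; congr (_ * _); exact: (congr1 (@^~ z) (esym Dphi)).
rewrite (slice_integralM iG (measurable_plateau k c r) (plateau_le1 k c r)).
have mphi : measurable_fun setT (fun z : R * R => phi z.1).
  by apply: measurableT_comp (measurable_plateau k c r) _; exact: measurable_fst.
transitivity (\int[lebesgue2]_z (fK z * derive1 psi z.2 * phi z.1 +
                                 vK z * psi z.2 * phi z.1)).
  by apply: eq_Rintegral => z _; rewrite mulrDl.
rewrite RintegralD//; first by rewrite E addNr.
  by apply: (integrable_mulr_bounded (C := 1)) => // z _; exact: plateau_le1.
by apply: (integrable_mulr_bounded (C := 1)) => // z _; exact: plateau_le1.
Qed.

(** Passage from pointwise to integrated growth. The plateaus in y are indexed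
    by their sharpness n and a rational endpoint, so almost every vertical line
    satisfies all the slice identities simultaneously; on such a line
    [plateau_primitive] and [growth_primitive] apply. The factor s serves both
    for lower bounds and, with a negative value, for upper bounds. *)
Lemma vertical_growth W f v c d a b q (s K : R) :
  c < d -> a < q < b -> measurable W -> box c d a b `<=` W ->
  measurable_fun W f -> (forall z, box c d a b z -> {for z, continuous f}) ->
  weak_partial W diry f v ->
  {ae lebesgue2, forall z, box c d a b z ->
    derivable f z diry /\ K <= s * 'D_diry f z} ->
  exists2 x, c < x < d & K * (q - a) <= s * (f (x, q) - f (x, a)).
Proof.
move=> cd aqb mW KW mf cf wv df.
have [aq qb] : a < q /\ q < b by case/andP: aqb.
have ab : a < b by exact: lt_trans qb.
have [aef [aev aeI]] := weak_partial_slices cd ab mW KW mf cf wv.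
(* The default 0 is harmless: every rational is the decoding of its code. *)
pose r_ k : R := ratr (odflt 0 (unpickle k : option rat)).
have {}aeI : {ae mu, forall x, forall n k, a < r_ k -> r_ k + n.+1%:R^-1 <= b ->
    c < x < d ->
    \int[mu]_y ((f \_ (box c d a b)) (x, y) * derive1 (plateau n a (r_ k)) y +
                (v \_ (box c d a b)) (x, y) * plateau n a (r_ k) y) = 0}.
  apply: ae_foralln => n; apply: ae_foralln => k.
  case: (pselect (a < r_ k /\ r_ k + n.+1%:R^-1 <= b)) => [[ar rb]|nar].
    by apply: ae_imply (aeI n _ ar rb) _ => x + _ _; exact.
  by apply: aeW => x ar rb; case: nar.
have := ae_imply2 (ae_imply2 aef aev (fun x => @conj _ _))
  (ae_imply2 aeI (ae_slice df) (fun x => @conj _ _)) (fun x => @conj _ _).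
move=> /(ae_itv_ex cd)[x /andP[cx xd] [[iw iv] [I0 dfx]]].
exists x; first by rewrite cx.
set w := fun y => (f \_ (box c d a b)) (x, y).
have wE y : a <= y <= b -> w y = f (x, y).
  move=> yab; rewrite /w patchE mem_set//; split; rewrite /= in_itv//=.
  by rewrite !ltW.
have cfx y : a <= y <= b -> {for y, continuous (fun t => f (x, t))}.
  move=> yab; apply: (@continuous_comp _ _ _ (fun t => (x, t)) f).
    exact: (cvg_pair (cvg_cst x) cvg_id).
  by apply: cf; split; rewrite /= in_itv//= !ltW.
have wr y : a <= y < b -> w t @[t --> y^'+] --> w y.
  move=> /andP[ay yb]; rewrite wE ?ay ?ltW//.
  have := cvg_at_right_filter (cfx y _); rewrite ay ltW// => /(_ isT).
  apply: cvg_trans; apply: near_eq_cvg; near=> t; rewrite wE//.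
  apply/andP; split; first by rewrite (le_trans ay)// ltW.
  by apply/ltW; near: t; exact: nbhs_right_lt.
have wab y : a < y < b -> \forall t \near y, f (x, t) = w t.
  move=> yab; have /near_in_itvoo : y \in `]a, b[ by rewrite in_itv.
  by apply: filterS => t; rewrite in_itv/= => /andP[at_ tb]; rewrite wE// !ltW.
have qE : a <= q <= b by rewrite !ltW.
have aE : a <= a <= b by rewrite lexx ltW.
rewrite -(wE q qE) -(wE a aE) [s * _]mulrBr.
pose v1 := fun y => (v \_ (box c d a b)) (x, y).
have isv : mu.-integrable setT (EFin \o (fun y => s * v1 y)).
  exact: integrable_mull.
apply: (@growth_primitive _ _ (fun y => s * w y) _ _ _ _ aqb isv).
- move=> r arb; have /andP[ar rb] := arb.
  rewrite RintegralZl//; last exact: integrableS iv.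
  rewrite -mulrBr; congr (_ * _).
  apply: (plateau_primitive arb) => //.
  + by apply: wr; rewrite lexx.
  + by apply: wr; rewrite ltW.
  + move=> n rnb; have := I0 n (pickle r).
    by rewrite /r_ pickleK/= cx xd => /(_ ar rnb isT).
- move=> t tab; have /andP[at_ tb] := tab; apply: cvgMr.
  have tE : a <= t <= b by rewrite !ltW.
  have := cfx t tE; rewrite /prop_for /continuous_at -(wE t tE).
  by apply: cvg_trans; apply: near_eq_cvg; exact: wab.
apply: ae_imply dfx _ => t + tab; have /andP[at_ tb] := tab.
have xt : box c d a b (x, t) by split; rewrite /= in_itv/= !ltW.
move=> /(_ xt)[]; rewrite derivable_diry derive_diry/= => dft Kt.
have dwt : derivable w t 1 by exact: near_eq_derivable (wab t tab) dft.
split; first by apply: derivableM => //; exact: derivable_cst.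
move: Kt; rewrite !derive1E (near_eq_derive _ (wab t tab)) => Kt.
have := is_deriveM (is_derive_cst s t 1) (derivableP dwt).
rewrite scaler0 addr0 => H; rewrite (_ : 'D_1 _ t = s * 'D_1 w t)//.
exact: derive_val.
Unshelve. all: by end_near. Qed.

End VerticalGrowth.

(** * Conformal maps at the axis *)

Section ConformalSingularities.
Context {R : realType}.
Local Notation mu := (@lebesgue_measure R).
Local Notation lebesgue2 := (mu \x mu)%E.
Local Notation Dmx := Defs.Dmx.
Local Notation jacobian := Defs.jacobian.
Implicit Types (g : R * R -> R * R) (U V : set (R * R)) (z : R * R).

(** Orthogonality of the rows and equality of their norms force the determinant
    to be plus or minus lambda^2; since the Jacobian is positive it is
    lambda^2, and then the squares of D00 - D11 and D10 + D01 add up to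
    2 lambda^2 - 2 det = 0. *)
Lemma cauchy_riemann (alpha lambda : R) g z (Q : 'M[R]_2) :
  (g z).1 != 0 -> Q *m Q^T = 1%:M -> Dmx alpha g z = lambda *: Q ->
  0 < jacobian alpha g z ->
  Dmx alpha g z 0 0 = Dmx alpha g z 1 1 /\
  Dmx alpha g z 1 0 = - Dmx alpha g z 0 1.
Proof.
move=> g0 QQ DQ; have h0 : 0 < `|(g z).1| `^ alpha by rewrite powR_gt0 ?normr_gt0.
have row i k : Dmx alpha g z i 0 * Dmx alpha g z k 0 +
    Dmx alpha g z i 1 * Dmx alpha g z k 1 = lambda ^+ 2 * (i == k)%:R.
  rewrite DQ; move/matrixP/(_ i k): QQ.
  rewrite !mxE !big_ord_recl big_ord0 !mxE addr0.
  rewrite (_ : lift ord0 ord0 = 1); last exact/val_inj.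
  by rewrite (_ : ord0 = 0)// => <-; ring.
have -> : jacobian alpha g z = `|(g z).1| `^ alpha *
   (Dmx alpha g z 0 0 * Dmx alpha g z 1 1 - Dmx alpha g z 1 0 * Dmx alpha g z 0 1).
  by rewrite /jacobian !mxE /=; field; rewrite gt_eqF.
rewrite pmulr_rgt0//.
have := row 0 0; have := row 0 1; have := row 1 1; rewrite /= !mulr1 mulr0.
move: (Dmx _ _ _ 0 0) (Dmx _ _ _ 0 1) (Dmx _ _ _ 1 0) (Dmx _ _ _ 1 1).
move=> A B C E CE orth AB det0.
have l0 : 0 <= lambda ^+ 2 by exact: sqr_ge0.
have : (A * E - C * B) ^+ 2 = (lambda ^+ 2) ^+ 2.
  have -> : (A * E - C * B) ^+ 2 =
     (A * A + B * B) * (C * C + E * E) - (A * C + B * E) ^+ 2 by ring.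
  by rewrite orth AB CE; ring.
move=> /eqP; rewrite eqrXn2// ?ltW// => /eqP det.
have : (A - E) ^+ 2 + (C + B) ^+ 2 = 0.
  have -> : (A - E) ^+ 2 + (C + B) ^+ 2 =
    (A * A + B * B) + (C * C + E * E) - 2 * (A * E - C * B) by ring.
  by rewrite AB CE det; ring.
move=> /eqP; rewrite paddr_eq0 ?sqr_ge0// !sqrf_eq0 subr_eq0 addr_eq0.
by move=> /andP[/eqP -> /eqP ->].
Qed.

(** The derivative along the vertical line at abscissa x is at least of order
    x^-alpha, so the increment over a fixed height tends to infinity as the
    line approaches the axis, although the oscillation stays below M. *)
Lemma vertical_blowup W (f v : R * R -> R) (alpha s c M e y0 : R) :
  0 < alpha -> 0 < c -> 0 < e -> `|s| <= 1 ->
  measurable W -> box (- e) e (y0 - e) (y0 + e) `<=` W -> measurable_fun W f ->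
  (forall z, box (- e) e (y0 - e) (y0 + e) z -> {for z, continuous f}) ->
  (forall z z', box (- e) e (y0 - e) (y0 + e) z ->
     box (- e) e (y0 - e) (y0 + e) z' -> `|f z - f z'| <= M) ->
  weak_partial W diry f v ->
  {ae lebesgue2, forall z, box (- e) e (y0 - e) (y0 + e) z -> 0 < z.1 ->
    derivable f z diry /\ c <= s * (`|z.1| `^ alpha * 'D_diry f z)} -> False.
Proof.
move=> a0 c0 e0 s1 mW KW mf cf fM wv df.
have M0 : 0 <= M.
  by apply: le_trans (fM (0, y0) (0, y0) _ _) => //; split; rewrite /= in_itv/=; lra.
(* With d^alpha <= t, growth c / d^alpha over height e exceeds M. *)
pose t := c * e / (M + 1).
have t0 : 0 < t by rewrite divr_gt0 ?mulr_gt0 ?ltr_wpDl.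
pose d := Num.min e (t `^ alpha^-1).
have d0 : 0 < d by rewrite lt_min e0 powR_gt0.
have de : d <= e by rewrite ge_min lexx.
have dat : d `^ alpha <= t.
  apply: (@le_trans _ _ ((t `^ alpha^-1) `^ alpha)).
    apply: ge0_ler_powR; rewrite ?nnegrE ?(ltW a0) ?(ltW d0) ?powR_ge0//.
    by rewrite /d ge_min lexx orbT.
  by rewrite -powRrM mulVf ?gt_eqF// powRr1// ltW.
have sub : box (d / 2) d (y0 - e) (y0 + e) `<=` box (- e) e (y0 - e) (y0 + e).
  move=> z [/=]; rewrite in_itv/= => /andP[z1 z2] z3; split => //=.
  by rewrite in_itv/=; apply/andP; split; [lra|exact: le_trans de].
have d2 : d / 2 < d by lra.
have y0e : y0 - e < y0 < y0 + e by apply/andP; split; lra.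
have dfd : {ae lebesgue2, forall z, box (d / 2) d (y0 - e) (y0 + e) z ->
    derivable f z diry /\ c / d `^ alpha <= s * 'D_diry f z}.
  apply: ae_imply df _ => z Hz Kz; have := Hz (sub _ Kz).
  have [/= +  _] := Kz; rewrite in_itv/= => /andP[z1 z2].
  have z0 : 0 < z.1 by lra.
  move=> /(_ z0)[dfz cz]; split => //.
  rewrite ler_pdivrMr ?powR_gt0//; apply: (le_trans cz).
  have sD : 0 < s * 'D_diry f z.
    have := lt_le_trans c0 cz; rewrite mulrCA pmulr_rgt0//.
    by rewrite powR_gt0 ?normr_gt0 ?gt_eqF.
  rewrite mulrCA mulrC ler_pM2l//.
  by apply: ge0_ler_powR; rewrite ?nnegrE ?(ltW a0) ?(ltW d0) ?ger0_norm ?(ltW z0).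
have [x /andP[dx xd]] := vertical_growth d2 y0e mW (subset_trans sub KW) mf
  (fun z Kz => cf z (sub z Kz)) wv dfd.
have xK : `|f (x, y0) - f (x, y0 - e)| <= M.
  by apply: fM; apply: sub; split; rewrite /= in_itv/= ?(ltW dx) ?(ltW xd)//=; lra.
have : s * (f (x, y0) - f (x, y0 - e)) <= M.
  apply: (le_trans (ler_norm _)); rewrite normrM -[leRHS]mul1r.
  by apply: ler_pM.
move=> sM /le_trans /(_ sM); rewrite opprB addrC subrK.
apply/negP; rewrite -ltNge.
rewrite mulrAC ltr_pdivlMr ?powR_gt0//.
apply: (@le_lt_trans _ _ (M * t)); first by rewrite ler_wpM2l.
have <- : (M + 1) * t = c * e by rewrite mulrC divfK// gt_eqF// ltr_wpDl.
by rewrite mulrDl mul1r ltrDl.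
Qed.
End ConformalSingularities.

Section SingularAxis.
Context {R : realType}.
Local Notation mu := (@lebesgue_measure R).
Local Notation lebesgue2 := (mu \x mu)%E.
Local Notation Dmx := Defs.Dmx.
Local Notation jacobian := Defs.jacobian.
Implicit Types (g : R * R -> R * R) (U V : set (R * R)) (z : R * R).

Lemma near_box (P : R * R -> Prop) z0 : (\forall z \near z0, P z) ->
  exists2 e, 0 < e & box (z0.1 - e) (z0.1 + e) (z0.2 - e) (z0.2 + e) `<=` P.
Proof.
move=> /nbhs_ballP[e /= e0 He]; exists (e / 2); first by rewrite divr_gt0.
move=> [x y] [/=]; rewrite !in_itv/= => /andP[x1 x2] /andP[y1 y2].
by apply: He; split; rewrite /ball/= ltr_norml; apply/andP; split; lra.
Qed.

(** If the map sends a point of the axis off the axis, the singular set near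
    this point is the axis itself, and some entry of the limit matrix is
    nonzero. By the Cauchy-Riemann relations an entry of the second column is
    then bounded away from zero with constant sign near the point: such an entry
    is |x|^alpha times a y-derivative, up to a factor bounded below by
    continuity. *)
Lemma conformal_growth (alpha : R) U V g z0 :
  0 < alpha -> open U -> conformal alpha U V g ->
  orientation_preserving alpha U V g ->
  U z0 -> z0.1 = 0 -> (g z0).1 <> 0 ->
  exists (f : R * R -> R) (s c : R),
  [/\ f = fst \o g \/ f = snd \o g, `|s| <= 1, 0 < c &
    exists N, nbhs z0 N /\
    {ae lebesgue2, forall z, N z -> 0 < z.1 ->
      derivable f z diry /\ c <= s * (`|z.1| `^ alpha * 'D_diry f z)}].
Proof.
move=> a0 oU [[cg _] _ [lambda [l0 aeQ]] limD] [_ aeJ] Uz0 x0 /eqP g0.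
have {}cg : {for z0, continuous g}.
  by move: cg; rewrite continuous_open_subspace// => cg; apply: cg; rewrite inE.
have cg1 : {for z0, continuous (fst \o g)}.
  by apply: continuous_comp; [exact: cg|exact: cvg_fst].
have [|L L0 DL] := limD z0; first by split => //; left.
have [i [j Lij]] : exists i j, L i j != 0.
  apply: contrapT => H; move/eqP: L0; apply; apply/matrixP => i j.
  by rewrite mxE; apply: contrapT => /eqP Lij; apply: H; exists i, j.
pose h0 := (`|(g z0).1| / 2) `^ alpha.
have h00 : 0 < h0 by rewrite powR_gt0// divr_gt0// normr_gt0.
pose s := Num.sg (L i j); pose c := `|L i j| / 2.
have s1 : `|s| <= 1 by rewrite normr_sg Lij.
have c0 : 0 < c by rewrite divr_gt0// normr_gt0.
have nD : \forall z \near z0, (regular U g `&` has_partials g) z ->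
    c <= s * Dmx alpha g z i j.
  have : (fun M : 'M[R]_2 => M i j) (Dmx alpha g z)
      @[z --> within (regular U g `&` has_partials g) (nbhs z0)] --> L i j.
    exact: cvg_comp DL (@coord_continuous _ _ _ i j L).
  move=> /cvgrPdist_lt/(_ _ c0); rewrite near_withinE; apply: filterS => z Hz Rz.
  have {Hz} LD := Hz Rz.
  have -> : s * Dmx alpha g z i j = `|L i j| - s * (L i j - Dmx alpha g z i j).
    by rewrite normrEsg -/s; ring.
  have := ler_norm (s * (L i j - Dmx alpha g z i j)); rewrite normrM.
  have := ler_pM (normr_ge0 s) (normr_ge0 _) s1 (ltW LD); rewrite mul1r /c; lra.
have nU : \forall z \near z0, U z by apply: open_nbhs_nbhs; split.
have ng : \forall z \near z0, (`|(g z0).1| / 2 < `|(g z).1|).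
  have /cvgrPdist_lt/(_ (`|(g z0).1| / 2)) := cg1.
  rewrite divr_gt0 ?normr_gt0// => /(_ isT); apply: filterS => z /=.
  have := ler_distD (g z).1 (g z0).1 0; rewrite !subr0; lra.
pose N := [set z | [/\ U z, `|(g z0).1| / 2 < `|(g z).1| &
  (regular U g `&` has_partials g) z -> c <= s * Dmx alpha g z i j]].
have nN : nbhs z0 N.
  by apply: filterS3 nU ng nD => z Uz gz Dz; split.
have aeCR : {ae lebesgue2, forall z, N z -> 0 < z.1 -> [/\ has_partials g z,
    h0 <= `|(g z).1| `^ alpha, c <= s * Dmx alpha g z i j,
    Dmx alpha g z 0 0 = Dmx alpha g z 1 1 &
    Dmx alpha g z 1 0 = - Dmx alpha g z 0 1]}.
  apply: ae_imply2 aeQ aeJ _ => z HQ HJ [Uz gz Dz] zp.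
  have gz0 : (g z).1 != 0.
    by rewrite -normr_gt0; apply: le_lt_trans gz; rewrite divr_ge0.
  have Rz : regular U g z.
    split => // -[_ [z10|gz1]]; first by rewrite z10 ltxx in zp.
    by rewrite gz1 eqxx in gz0.
  have [pz Jz] := HJ Uz; have [_ [Q QQ DQ]] := HQ Rz.
  have [DE DC] := cauchy_riemann gz0 QQ DQ Jz.
  split => //; last exact: Dz.
  by apply: ge0_ler_powR; rewrite ?nnegrE ?divr_ge0 ?(ltW a0) ?(ltW gz).
have ch0 : 0 < c * h0 by rewrite mulr_gt0.
have caseE (f : R * R -> R) (t k : R) :
    f = fst \o g \/ f = snd \o g -> `|t| <= 1 -> 0 < k ->
    (forall z, [/\ has_partials g z, h0 <= `|(g z).1| `^ alpha,
       c <= s * Dmx alpha g z i j, Dmx alpha g z 0 0 = Dmx alpha g z 1 1 &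
       Dmx alpha g z 1 0 = - Dmx alpha g z 0 1] -> k <= t * vfY alpha f z) ->
  exists (f : R * R -> R) (s c : R),
  [/\ f = fst \o g \/ f = snd \o g, `|s| <= 1, 0 < c &
    exists N, nbhs z0 N /\
    {ae lebesgue2, forall z, N z -> 0 < z.1 ->
      derivable f z diry /\ c <= s * (`|z.1| `^ alpha * 'D_diry f z)}].
  move=> fg t1 k0 H; exists f, t, k; split => //; exists N; split => //.
  apply: ae_imply aeCR _ => z Hz Nz z1; have Hz' := Hz Nz z1.
  split; last exact: H Hz'.
  have [pz _ _ _ _] := Hz'; have [d1 d2] := pz _ (or_intror erefl).
  by case: fg => ->.
have i2 (k : 'I_2) : k = 0 \/ k = 1.
  by case: k => [[|[|//]]] ?; [left|right]; exact/val_inj.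
have col2 z : h0 <= `|(g z).1| `^ alpha -> c <= s * Dmx alpha g z 1 1 ->
    c * h0 <= s * vfY alpha (snd \o g) z.
  move=> hz; rewrite !mxE/= mulrA ler_pdivlMr ?(lt_le_trans h00)//.
  by apply: le_trans; rewrite ler_pM2l.
(* First-column entries are traded for second-column ones. *)
case: (i2 i) => ie; case: (i2 j) => je; rewrite ie je in caseE.
- apply: (caseE (snd \o g) s (c * h0)) => //; first by right.
  by move=> z [_ hz cD DE _]; apply: col2 => //; rewrite -DE.
- apply: (caseE (fst \o g) s c) => //; [left => //|move=> z [_ _ cD _ _]].
  by move: cD; rewrite !mxE.
- apply: (caseE (fst \o g) (- s) c) => //; first by left.
    by rewrite normrN.
  by move=> z [_ _ cD _ DC]; move: cD; rewrite DC !mxE/= mulrN mulNr.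
- apply: (caseE (snd \o g) s (c * h0)) => //; first by right.
  by move=> z [_ hz cD _ _]; exact: col2.
Qed.

(** The growth of a component near the axis contradicts its continuity by
    [vertical_blowup]. *)
Lemma conformal_axis (alpha : R) U V g z0 :
  0 < alpha -> open U -> conformal alpha U V g ->
  orientation_preserving alpha U V g ->
  U z0 -> z0.1 = 0 -> (g z0).1 = 0.
Proof.
move=> a0 oU Cg Og Uz0 x0; apply: contrapT => g0.
have [f [s [c [fE s1 c0 [N [nN df]]]]]] := conformal_growth a0 oU Cg Og Uz0 x0 g0.
have [[cg _] hw _ _] := Cg.
have cf z : U z -> {for z, continuous f}.
  move=> Uz; have {}cg : {for z, continuous g}.
    by move: cg; rewrite continuous_open_subspace// => cg; apply: cg; rewrite inE.
  case: fE => ->; apply: continuous_comp; [exact: cg|exact: cvg_fst|exact: cg|].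
  exact: cvg_snd.
have nf : \forall z \near z0, `|f z0 - f z| < 1.
  by have /cvgrPdist_lt/(_ _ ltr01) := cf _ Uz0.
have nU : \forall z \near z0, U z by apply: open_nbhs_nbhs; split.
have nP : \forall z \near z0, [/\ U z, N z & `|f z0 - f z| < 1].
  by apply: filterS3 nU nN nf => z.
have [e e0] := near_box nP.
rewrite x0 !add0r => He.
(* An open box between two closed ones: compactly contained in U, it carries
   the weak derivatives, and the smaller closed box lies inside it. *)
pose W := `]- e, e[%classic `*` `]z0.2 - e, z0.2 + e[%classic : set (R * R).
have mW : measurable (W : set (measurableTypeR R * measurableTypeR R)).
  by apply: measurableX; exact: measurable_itv.
have oW : open W.
  apply: openI; apply: open_comp; try exact: interval_open.
    by move=> z _; exact: cvg_fst.
  by move=> z _; exact: cvg_snd.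
have WK : closure W `<=` box (- e) e (z0.2 - e) (z0.2 + e).
  rewrite [X in _ `<=` X](closure_id _).1; last exact: closed_box.
  by apply: closure_subset => z [z1 z2]; split; exact: subset_itv_oo_cc.
have cW : compact (closure W).
  apply: (subclosed_compact _ (@compact_box _ (- e) e (z0.2 - e) (z0.2 + e))) => //.
  exact: closed_closure.
have WU : closure W `<=` U by move=> z /WK/He[].
have [_ hw1 hw2] := hw W oW cW WU.
have [[mf _] [ux [uy [_ wy _ _]]]] : HW alpha 2 W f by case: fE => ->.
have KW : box (- (e / 2)) (e / 2) (z0.2 - e / 2) (z0.2 + e / 2) `<=` W.
  move=> z [] /=; rewrite !in_itv/= => /andP[z1 z2] /andP[z3 z4].
  by split; rewrite /= in_itv/=; apply/andP; split; lra.
have KK : box (- (e / 2)) (e / 2) (z0.2 - e / 2) (z0.2 + e / 2) `<=`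
    box (- e) e (z0.2 - e) (z0.2 + e).
  by move=> z /KW Wz; apply: WK; exact: subset_closure.
have e20 : 0 < e / 2 by rewrite divr_gt0.
apply: (vertical_blowup (M := 2) a0 c0 e20 s1 mW KW mf _ _ wy).
- by move=> z /KK/He[Uz _ _]; exact: cf.
- move=> z z' /KK/He[_ _ fz] /KK/He[_ _ fz'].
  have := ler_distD (f z0) (f z) (f z'); rewrite (distrC (f z) (f z0)); lra.
- apply: ae_imply df _ => z Hz /KK/He[_ Nz _]; exact: Hz.
Qed.

End SingularAxis.

(** * Sheared domains *)

Section ShearedDomains.
Context {R : realType}.
Implicit Types (U : set (R * R)) (I : set R) (k : R -> R) (z : R * R).

(** The image of the product of I with the line under the shear
    (x, y) |-> (x + k y, y). *)
Definition sheared I k : set (R * R) := [set z | I (z.1 - k z.2)].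

Lemma contractible_simply_connected U (H : R * (R * R) -> R * R) p :
  continuous H -> (forall z, H (0, z) = z) -> (forall z, H (1, z) = p) ->
  (forall s z, s \in `[0, 1] -> U z -> U (H (s, z))) -> simply_connected U.
Proof.
move=> cH H0 H1 HU c cc cU c01; exists (fun st => H (st.1, c st.2)), p; split.
- apply/subspace_continuousP => st [s01 t01].
  have snd01 : snd @ within (`[0, 1] `*` `[0, 1]) (nbhs st) -->
      within (`[0, 1]%classic : set R) (nbhs st.2).
    move=> A nA; have csnd : {for st, continuous (@snd R R)} by exact: cvg_snd.
    have {}nA : nbhs st [set x | `[0, 1]%classic x.2 -> A x.2] := csnd _ nA.
    suff : nbhs st [set x | (`[0, 1] `*` `[0, 1]) x -> A x.2] by [].
    by apply: filterS nA => x Ax [_ x2]; exact: Ax.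
  have /subspace_continuousP/(_ _ t01) cst2 := cc.
  have fst01 : fst @ within (`[0, 1] `*` `[0, 1]) (nbhs st) --> st.1.
    by apply: cvg_within_filter; exact: cvg_fst.
  exact: cvg_comp (cvg_pair fst01 (cvg_comp _ _ snd01 cst2)) (cH (st.1, c st.2)).
- by move=> _ [st [s01 t01] <-]; apply: HU => //; apply: cU; exists st.2.
- by move=> t _; rewrite H0.
- by move=> t _; rewrite H1.
- by move=> s _; rewrite c01.
Qed.

(** Every point is joined to p by its own trajectory. *)
Lemma contractible_connected U (H : R * (R * R) -> R * R) p :
  continuous H -> (forall z, H (0, z) = z) -> (forall z, H (1, z) = p) ->
  (forall s z, s \in `[0, 1] -> U z -> U (H (s, z))) -> connected U.
Proof.
move=> cH H0 H1 HU.
have -> : U = \bigcup_(z in U) ((fun s => H (s, z)) @` `[0, 1]%classic).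
  apply/seteqP; split => [z Uz|_ [z Uz [s s01 <-]]]; last exact: HU.
  by exists z => //; exists 0; [rewrite /= in_itv/= lexx ler01|].
apply: bigcup_connected.
  by exists p => z Uz; exists 1; [rewrite /= in_itv/= ler01 lexx|].
move=> z Uz; apply: connected_continuous_connected.
  by apply/connected_intervalP; exact: interval_is_interval.
apply: continuous_subspaceT => s; apply: continuous_comp; last exact: cH.
exact: (cvg_pair cvg_id (cvg_cst z)).
Qed.

(** The linear contraction of the product onto (e, 0), conjugated by the
    shear. *)
Definition shear_contraction k (e : R) (sz : R * (R * R)) : R * R :=
  ((1 - sz.1) * (sz.2.1 - k sz.2.2) + sz.1 * e + k ((1 - sz.1) * sz.2.2),
   (1 - sz.1) * sz.2.2).

Lemma continuous_shear_contraction k e :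
  continuous k -> continuous (shear_contraction k e).
Proof.
move=> ck sz.
have c1 : {for sz, continuous (fun sz : R * (R * R) => sz.1)} by exact: cvg_fst.
have c2 : {for sz, continuous (fun sz : R * (R * R) => sz.2.1)}.
  by apply: (@continuous_comp _ _ _ snd fst); [exact: cvg_snd|exact: cvg_fst].
have c3 : {for sz, continuous (fun sz : R * (R * R) => sz.2.2)}.
  by apply: (@continuous_comp _ _ _ snd snd); exact: cvg_snd.
have c4 : {for sz, continuous (fun sz : R * (R * R) => (1 - sz.1) * sz.2.2)}.
  by apply: cvgM => //; apply: cvgB => //; exact: cvg_cst.
have c5 : {for sz, continuous (fun sz : R * (R * R) => (1 - sz.1) *
    (sz.2.1 - k sz.2.2) + sz.1 * e + k ((1 - sz.1) * sz.2.2))}.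
  apply: cvgD; last by apply: (continuous_comp c4); exact: ck.
  apply: cvgD; last by apply: cvgM => //; exact: cvg_cst.
  apply: cvgM; first by apply: cvgB => //; exact: cvg_cst.
  by apply: cvgB => //; apply: (continuous_comp c3); exact: ck.
exact: (cvg_pair c5 c4).
Qed.

Lemma shear_contraction_in I k e s z : is_interval I -> I e ->
  s \in `[0, 1] -> sheared I k z -> sheared I k (shear_contraction k e (s, z)).
Proof.
move=> iI Ie; rewrite in_itv/= => /andP[s0 s1]; rewrite /sheared /= addrK => Iz.
set w := z.1 - k z.2 in Iz *.
have [we|/ltW ew] := leP w e.
  by apply: (iI _ _ Iz Ie); apply/andP; split; nra.
by apply: (iI _ _ Ie Iz); apply/andP; split; nra.
Qed.

Lemma sheared_domain I k e : continuous k -> open I -> is_interval I -> I e ->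
  simply_connected_domain (sheared I k).
Proof.
move=> ck oI iI Ie.
have cH : continuous (shear_contraction k e) by exact: continuous_shear_contraction.
have H0 z : shear_contraction k e (0, z) = z.
  case: z => x y; rewrite /shear_contraction /= subr0 !mul1r mul0r addr0.
  by rewrite subrK.
have H1 z : shear_contraction k e (1, z) = (e + k 0, 0).
  by rewrite /shear_contraction /= subrr !mul0r mul1r add0r.
have HU s z : s \in `[0, 1] -> sheared I k z ->
    sheared I k (shear_contraction k e (s, z)) := shear_contraction_in iI Ie.
split.
- apply: open_comp oI => z _; apply: cvgB; first exact: cvg_fst.
  by apply: (@continuous_comp _ _ _ snd k); [exact: cvg_snd|exact: ck].
- by exists (e + k 0, 0); rewrite /sheared /= addrK.
- exact: contractible_connected cH H0 H1 HU.
- exact: contractible_simply_connected cH H0 H1 HU.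
Qed.

End ShearedDomains.

(** * The snake and the star *)

Section SnakeAndStar.
Context {R : realType}.
Implicit Types (y : R) (z : R * R) (g : R * R -> R * R).

(** Vanishes at -2, 0 and 2, and takes the values 3 at -1 and -3 at 1. *)
Definition wave y := y * (y - 2) * (y + 2).

(** A strip following the graph of [wave]; it crosses the axis three times, each
    time passing to the other side. *)
Definition snake : set (R * R) := sheared `]-1, 1[%classic wave.

(** A region lying mostly to the right of the axis, with three teeth that cross
    the axis exactly where [snake] does. *)
Definition star : set (R * R) := sheared `]0, +oo[%classic (fun y => `|wave y| - 1).

(** The part of [star] to the right of the axis; all three teeth are attached to
    it. *)
Definition core : set (R * R) :=
  sheared `]0, +oo[%classic (fun y => Num.max (`|wave y| - 1) 0).

Lemma continuous_wave : continuous wave.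
Proof.
move=> y; apply: cvgM; last by apply: cvgD; [exact: cvg_id|exact: cvg_cst].
apply: cvgM; first exact: cvg_id.
by apply: cvgB; [exact: cvg_id|exact: cvg_cst].
Qed.

Lemma continuous_wall : continuous (fun y => `|wave y| - 1).
Proof.
move=> y; apply: cvgB; last exact: cvg_cst.
by apply: cvg_norm; exact: continuous_wave.
Qed.

Lemma snake_domain : simply_connected_domain snake.
Proof.
apply: (@sheared_domain _ _ _ 0); first exact: continuous_wave.
- exact: interval_open.
- exact: interval_is_interval.
- by rewrite /= in_itv/=; lra.
Qed.

Lemma star_domain : simply_connected_domain star.
Proof.
apply: (@sheared_domain _ _ _ 1); first exact: continuous_wall.
- exact: interval_open.
- exact: interval_is_interval.
- by rewrite /= in_itv/= ltr01.
Qed.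

Lemma connected_core : connected core.
Proof.
have ck : continuous (fun y => Num.max (`|wave y| - 1) 0).
  by move=> y; exact: (continuous_max (@continuous_wall y) (cvg_cst _)).
suff : simply_connected_domain core by case.
apply: (@sheared_domain _ _ _ 1 ck).
- exact: interval_open.
- exact: interval_is_interval.
- by rewrite /= in_itv/= ltr01.
Qed.

Lemma coreE z : core z <-> star z /\ 0 < z.1.
Proof.
rewrite /core /star /sheared /= !in_itv/= !andbT !subr_gt0 gt_max.
by split => [/andP[]|[-> ->]].
Qed.

Lemma axis_sections : snake `&` y_axis = star `&` y_axis.
Proof.
apply/seteqP; split => -[x y] [+ /= x0]; rewrite /y_axis /= in x0;
  rewrite /snake /star /sheared /= !in_itv/= andbT x0 => H; split => //=.
  by move: H; rewrite sub0r -ltr_norml normrN; lra.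
move: H; rewrite sub0r opprB subr_gt0 ltr_norml => /andP[]; lra.
Qed.

(** Suppose that the axis of [snake] goes into the axis. The preimage E of the
    connected set [core] then avoids the axis, so it lies on one side of it. But
    the axis of [star] is in the closure of [core], so E comes close to
    (0, 2) and (0, -2); being connected, it reaches the heights 1 and -1, where
    [snake] is on opposite sides of the axis. *)
Lemma snake_star_axis g : homeomorphism_onto snake star g ->
  exists2 z, snake z & z.1 = 0 /\ (g z).1 <> 0.
Proof.
move=> [cg [g' [cg' gU gV gK g'K]]]; apply: contrapT => nax.
have axis z : snake z -> z.1 = 0 -> (g z).1 = 0.
  by move=> Sz z0; apply: contrapT => gz0; apply: nax; exists z.
have [oS _ _ _] := snake_domain; have [oT _ _ _] := star_domain.
pose E := g' @` core.
have coreT z : core z -> star z by move=> /coreE[].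
have ES z : E z -> snake z.
  by move=> [w Cw <-]; apply: gV; exists w => //; exact: coreT.
have cE : connected E.
  apply: connected_continuous_connected connected_core _.
  exact: continuous_subspaceW cg'.
have E0 z : E z -> z.1 <> 0.
  move=> Ez z0; have gz0 := axis z (ES z Ez) z0; move: Ez => [w Cw wz].
  move: gz0; rewrite -wz g'K ?inE; [|exact: coreT].
  by move/coreE: Cw => [_ w0] w00; rewrite w00 ltxx in w0.
have nearE y : wave y = 0 -> forall e, 0 < e -> exists2 z, E z & `|y - z.2| < e.
  move=> wy e e0.
  have Sy : snake (0, y) by rewrite /snake /sheared /= wy in_itv/=; lra.
  pose q := g (0, y).
  have q0 : q.1 = 0 by exact: axis.
  have Tq : star q by apply: gU; exists (0, y).
  have g'q : g' q = (0, y) by rewrite /q gK// inE.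
  have cq : {for q, continuous (snd \o g')}.
    apply: continuous_comp; last exact: cvg_snd.
    by move: cg'; rewrite continuous_open_subspace// => cg'; apply: cg'; rewrite inE.
  have /cvgrPdist_lt/(_ e e0) := cq; rewrite /= g'q /=.
  move=> /nbhs_ballP[d /= d0 Hd].
  (* A point of the core just to the right of q. *)
pose w := (d / 2, q.2).
  have Cw : core w.
    apply/coreE; rewrite /w /=; split; last by rewrite divr_gt0.
    move: Tq; rewrite /star /sheared /= !in_itv/= !andbT q0 !subr_gt0.
    by move=> /lt_trans; apply; rewrite divr_gt0.
  exists (g' w); first by exists w.
  apply: Hd; split; rewrite /= /ball/= ?subrr ?normr0// q0 sub0r normrN gtr0_norm//.
    lra.
  by rewrite divr_gt0.
have [z1 Ez1 z1e] : exists2 z, E z & `|2 - z.2| < 1.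
  by apply: nearE => //; rewrite /wave; ring.
have [z2 Ez2 z2e] : exists2 z, E z & `|- 2 - z.2| < 1.
  by apply: nearE => //; rewrite /wave; ring.
have iy : is_interval (snd @` E).
  apply/connected_intervalP; apply: connected_continuous_connected => //.
  by apply: continuous_subspaceT => z; exact: cvg_snd.
have ix : is_interval (fst @` E).
  apply/connected_intervalP; apply: connected_continuous_connected => //.
  by apply: continuous_subspaceT => z; exact: cvg_fst.
have ey y : - 1 <= y <= 1 -> exists2 z, E z & z.2 = y.
  move=> y1; have [|||z Ez zy] := iy z2.2 z1.2 _ _ y; last by exists z.
  - by exists z2.
  - by exists z1.
  by move: z1e z2e; rewrite !ltr_norml; lra.
have [p Ep p1] := ey 1 ltac:(lra); have [n En n1] := ey (- 1) ltac:(lra).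
have := ES p Ep; have := ES n En.
rewrite /snake /sheared /= !in_itv/= p1 n1 /wave => /andP[nw _] /andP[_ pw].
have [|||z Ez z0] := ix p.1 n.1 _ _ 0.
- by exists p.
- by exists n.
- by apply/andP; split; lra.
exact: E0 z Ez z0.
Qed.

End SnakeAndStar.

Theorem mainTheorem6 (R : realType) (alpha : R) (alpha_gt0 : 0 < alpha) :
  exists U V : set (R * R),
    [/\ simply_connected_domain U,
        simply_connected_domain V,
        (components (U `&` y_axis) #= components (V `&` y_axis))%card &
        ~ exists g : R * R -> R * R,
            [/\ HW_map_loc alpha (2 * (alpha + 1) / alpha) U V g,
                orientation_preserving alpha U V g &
                conformal alpha U V g]].
Proof.
exists snake, star; split; [exact: snake_domain|exact: star_domain| |].
  by rewrite axis_sections card_eqxx.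
move=> [g [_ Og Cg]]; have [hg _ _ _] := Cg.
have [z Sz [z0 gz0]] := snake_star_axis hg.
have [oS _ _ _] := @snake_domain R.
exact: gz0 (conformal_axis alpha_gt0 oS Cg Og Sz z0).
Qed.
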